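(* Let $X$ be a Banach space which fails the approximation property, and let $Z=Z_X$ be the Willis space associated to $X$ (as described in the context). Then there is a linear isomorphic embedding $\psi: c_0 \to \mathcal K(Z)/\mathcal A(Z)$, i.e. $\mathcal K(Z)/\mathcal A(Z)$ contains a closed subspace linearly isomorphic to $c_0$.
   Context: For Banach spaces $X,Y$, $\mathcal K(X,Y)$ denotes the compact operators $X\to Y$ with the operator norm, $\mathcal F(X,Y)$ the bounded finite rank operators, $\mathcal A(X,Y)=\overline{\mathcal F(X,Y)}$ the approximable operators; $\mathcal K(X)=\mathcal K(X,X)$, $\mathcal A(X)=\mathcal A(X,X)$, and $\mathcal K(X)/\mathcal A(X)$ is the quotient Banach algebra with norm $\|T+\mathcal A(X)\|=\inf_{S\in\mathcal A(X)}\|T-S\|$. $X$ has the approximation property (A.P.) if for every compact $K\subset X$ and $\varepsilon>0$ there is $T\in\mathcal F(X)$ with $\sup_{x\in K}\|x-Tx\|\le\varepsilon$. Willis space: Since $X$ fails the A.P., one may fix a sequence $(x_n)$ in $X$ with $0<\|x_n\|\le 1$ and $\|x_n\|\to 0$, and a constant $c>0$, such that $K=\overline{conv}\{\pm x_n:n\in\mathbb N\}$ satisfies $\sup_{x\in K}\|x-Vx\|\ge c$ for every $V\in\mathcal F(X)$. For $0<t<1$ let $U_t=\overline{conv}\{\pm x_n/\|x_n\|^t: n\in\mathbb N\}\subset X$, let $Y_t$ be the linear span of $U_t$ in $X$, normed by the Minkowski functional $|x|_t=\inf\{\lambda>0: x\in\lambda U_t\}$ (then $(Y_t,|\cdot|_t)$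 is a Banach space, $Y_s\subset Y_t$ and $\|x\|\le|x|_t\le|x|_s$ for $x\in Y_s$, $0<s<t<1$). Let $\mathcal Z$ be the linear span of the functions $y\chi_{(s,t)}$ on $(0,1)$ with $0<s<t<1$, $y\in Y_s$, normed by $\|f\|=\int_0^1|f(r)|_r\,dr$, i.e. $\|f\|=\sum_{k=1}^n\int_{u_k}^{v_k}|y_k|_r\,dr$ for $f=\sum_{k=1}^n y_k\chi_{(u_k,v_k)}$ with $0<u_1<v_1\le u_2<\dots\le u_n<v_n<1$, $y_k\in Y_{u_k}$. The Willis space $Z=Z_X$ is the completion of $(\mathcal Z,\|\cdot\|)$. *)

(* Defs.v *)
From HB Require Import structures.
From mathcomp Require Import all_boot all_order all_algebra.
From mathcomp Require Import all_classical all_reals all_analysis.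
Set Implicit Arguments. Unset Strict Implicit. Unset Printing Implicit Defensive.
Import Order.TTheory GRing.Theory Num.Theory.
Import numFieldNormedType.Exports.
Local Open Scope classical_set_scope.
Local Open Scope ring_scope.

Section Ops.
Variable R : realType.

Definition bounded_linear (V W : normedModType R) (T : V -> W) : Prop :=
  (forall (a : R) (u v : V), T (a *: u + v) = a *: T u + T v) /\
  exists M : R, forall v, `|T v| <= M * `|v|.

Definition finite_rank (V W : normedModType R) (T : V -> W) : Prop :=
  bounded_linear T /\
  exists (n : nat) (w : 'I_n -> W),
    forall v, exists c : 'I_n -> R, T v = \sum_(i < n) c i *: w i.

Definition compact_op (V W : normedModType R) (T : V -> W) : Prop :=
  bounded_linear T /\ compact (closure [set T v | v in [set v : V | `|v| <= 1]]).

Definition opnorm (V W : normedModType R) (T : V -> W) : R :=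
  sup [set `|T v| | v in [set v : V | `|v| <= 1]].

Definition approximable (V W : normedModType R) (T : V -> W) : Prop :=
  bounded_linear T /\
  forall e : R, 0 < e -> exists S : V -> W,
    finite_rank S /\ opnorm (fun v => T v - S v) <= e.

Definition qnorm (V W : normedModType R) (T : V -> W) : R :=
  inf [set opnorm (fun v => T v - S v) | S in [set S : V -> W | approximable S]].

Definition has_AP (V : normedModType R) : Prop :=
  forall K : set V, compact K -> forall e : R, 0 < e ->
    exists T : V -> V, finite_rank T /\ forall y, K y -> `|y - T y| <= e.

Definition conv_hull (V : normedModType R) (A : set V) : set V :=
  [set y | exists (n : nat) (l : 'I_n -> R) (p : 'I_n -> V),
     (forall i, 0 <= l i) /\ \sum_(i < n) l i = 1 /\ (forall i, A (p i)) /\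
     y = \sum_(i < n) l i *: p i].

Definition lin_span (V : normedModType R) (A : set V) : set V :=
  [set y | exists (n : nat) (c : 'I_n -> R) (p : 'I_n -> V),
     (forall i, A (p i)) /\ y = \sum_(i < n) c i *: p i].

Definition minkowski (V : normedModType R) (U : set V) (y : V) : \bar R :=
  ereal_inf [set (l%:E) | l in [set l : R | 0 < l /\ exists u, U u /\ y = l *: u]].

Definition c0 (a : nat -> R) : Prop := a n @[n --> \oo] --> (0 : R).
Definition supnorm (a : nat -> R) : R := sup (range (fun n => `|a n|)).

Section Willis.
Variable X : normedModType R.
Variable x : nat -> X.

Definition K_set : set X :=
  closure (conv_hull [set y | exists n, y = x n \/ y = - x n]).

Definition U_t (t : R) : set X :=
  closure (conv_hull [set y | exists n, y = (`|x n| `^ t)^-1 *: x n \/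
                                       y = - ((`|x n| `^ t)^-1 *: x n)]).
Definition Y_t (t : R) : set X := lin_span (U_t t).
Definition norm_t (t : R) (y : X) : \bar R := minkowski (U_t t) y.

Definition step_fun (s t : R) (y : X) : R -> X :=
  fun r => if (s < r) && (r < t) then y else 0.

Definition Zcal : set (R -> X) :=
  [set f | exists (n : nat) (s t : 'I_n -> R) (y : 'I_n -> X),
     (forall i, 0 < s i /\ s i < t i /\ t i < 1 /\ Y_t (s i) (y i)) /\
     f = (fun r => \sum_(i < n) step_fun (s i) (t i) (y i) r)].

Definition Znorm (f : R -> X) : \bar R :=
  (\int[@lebesgue_measure R]_(r in [set r : R | (0 < r < 1)%R]) norm_t r (f r))%E.

Definition is_completion (Z : normedModType R) (J : (R -> X) -> Z) : Prop :=
  (forall (f g : R -> X) (a : R), Zcal f -> Zcal g ->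
      J (fun r => a *: f r + g r) = a *: J f + J g) /\
  (forall f, Zcal f -> (`|J f|)%:E = Znorm f) /\
  (forall (z : Z) (e : R), 0 < e -> exists f, Zcal f /\ `|z - J f| < e).

End Willis.
End Ops.

(* Main.v *)
Require Import Defs.
From HB Require Import structures.
From mathcomp Require Import all_boot all_order all_algebra.
From mathcomp Require Import all_classical all_reals all_analysis.
From mathcomp Require Import measurable_realfun ring lra.
Import Order.TTheory GRing.Theory Num.Theory.
Import numFieldNormedType.Exports.
Local Open Scope classical_set_scope.
Local Open Scope ring_scope.

(** Let [g_a] be the function on [(0, 1)] equal to [a_n] on
    [(1 / (n + 5), 1 / (n + 4))] and to [0] on [(1 / 4, 1)].  The operator
    [psi a] sends [f] to [4 y chi_(1/2, 3/4)], where [y] is the integral of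
    [g_a f].

    Since [g_a] lives on [(0, 1/4]] and is bounded by [|a|], the vector [y]
    lies in [|a| |f| U_(1/4)]: a functional separating it from that set would
    contradict [|g_a xi(f)| <= |a| |f(r)|_r].  So [psi a] factors through the
    inclusion of [Y_(1/4)] into [Y_(1/2)], which is compact because [x_n]
    tends to [0], and [|psi a| <= |a|].

    Conversely let [T] be of finite rank.  Restricting [psi a - T] to the
    functions [k chi_I / |I|], where [g_a = a_n] on [I] and [k] is in [K], and
    integrating the result over [(1/2, 3/4)] yields [a_n k - V k], where [V]
    has finite rank but is only continuous for the gauge of some [U_u].  As [K]
    is precompact for that gauge, Hahn-Banach approximates [V] uniformly on [K]
    by finite rank operators on [X], hence [c |a_n| <= |psi a - T|]. *)

Set Implicit Arguments.
Unset Strict Implicit.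

(** * Elementary identities for linear maps between modules *)

Section LinearMaps.
Variables (R : realType) (V W : lmodType R) (f : V -> W).
Hypothesis linf : forall (a : R) u v, f (a *: u + v) = a *: f u + f v.

Lemma lin0 : f 0 = 0.
Proof.
have := linf 0 0 0; rewrite !scale0r !add0r => _.
by have := linf (-1) 0 0; rewrite scaler0 addr0 scaleN1r addNr.
Qed.

Lemma linZ a u : f (a *: u) = a *: f u.
Proof. by rewrite -[a *: u]addr0 linf lin0 addr0. Qed.

Lemma linD u v : f (u + v) = f u + f v.
Proof. by rewrite -{1}[u]scale1r linf scale1r. Qed.

Lemma linN u : f (- u) = - f u.
Proof. by rewrite -scaleN1r linZ scaleN1r. Qed.

Lemma linB u v : f (u - v) = f u - f v.
Proof. by rewrite linD linN. Qed.

Lemma lin_sum (I : Type) (r : seq I) (F : I -> V) :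
  f (\sum_(i <- r) F i) = \sum_(i <- r) f (F i).
Proof.
elim: r => [|i r IH]; first by rewrite !big_nil lin0.
by rewrite !big_cons linD IH.
Qed.

End LinearMaps.

(** * The Hahn-Banach theorem in terms of cones of constraints *)

Section HahnBanach.
Variable R : realType.

(** A pair [(v, a)] stands for the constraint [xi v <= a] on a functional to be found; such
    constraints may be added and multiplied by nonnegative scalars. *)
Definition cone (V : lmodType R) (G : set (V * R)) : Prop :=
  (forall p q, G p -> G q -> G (p.1 + q.1, p.2 + q.2)) /\
  (forall (t : R) p, 0 <= t -> G p -> G (t *: p.1, t * p.2)).

(* A maximal cone without points [(0, a)], [a < 0], is the epigraph of a
   linear functional: it contains [(v, a)] and [(- v, - a)] for exactly one
   [a]. *)
Lemma hahn_banach_cone (V : lmodType R) (G0 : set (V * R)) :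
  cone G0 -> (forall a, G0 (0, a) -> 0 <= a) ->
  (forall v, exists a, G0 (v, a)) ->
  exists2 xi : V -> R^o,
    (forall (a : R) u v, xi (a *: u + v) = a *: xi u + xi v) &
    forall v a, G0 (v, a) -> xi v <= a.
Proof.
move=> coneG0 pos0 abs0.
pose P (G : set (V * R)) :=
  G = set0 \/ [/\ cone G, (forall a, G (0, a) -> 0 <= a) & G0 `<=` G].
have [F FP Ftot|G [PG Gmax]] := @Zorn_bigcup _ P.
  have [[A [FA [p Ap]]]|F0] := pselect (exists A, F A /\ A !=set0); last first.
    left; rewrite -subset0 => p [A FA Ap]; apply: F0; exists A; split => //.
    by exists p.
  have PF B : F B -> B !=set0 ->
      [/\ cone B, (forall a, B (0, a) -> 0 <= a) & G0 `<=` B].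
    by move=> FB [b Bb]; case: (FP _ FB) => // B0; rewrite B0 in Bb.
  right; split; first split.
  - move=> q r [B FB Bq] [C FC Cr].
    have [BC|CB] := Ftot _ _ FB FC.
      have [[+ _] _ _] : [/\ cone C, (forall a, C (0, a) -> 0 <= a) & G0 `<=` C].
        by apply: PF => //; exists r.
      by move=> /(_ q r (BC _ Bq) Cr); exists C.
    have [[+ _] _ _] : [/\ cone B, (forall a, B (0, a) -> 0 <= a) & G0 `<=` B].
      by apply: PF => //; exists q.
    by move=> /(_ q r Bq (CB _ Cr)); exists B.
  - move=> t q t0 [B FB Bq].
    have [[_ +] _ _] : [/\ cone B, (forall a, B (0, a) -> 0 <= a) & G0 `<=` B].
      by apply: PF => //; exists q.
    by move=> /(_ t q t0 Bq); exists B.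
  - move=> a [B FB Ba].
    have [_ + _] : [/\ cone B, (forall a, B (0, a) -> 0 <= a) & G0 `<=` B].
      by apply: PF => //; exists (0, a).
    exact.
  - have [_ _ G0A] : [/\ cone A, (forall a, A (0, a) -> 0 <= a) & G0 `<=` A].
      by apply: PF => //; exists p.
    by move=> q /G0A Aq; exists A.
have [[GD GZ] posG G0G] :
    [/\ cone G, (forall a, G (0, a) -> 0 <= a) & G0 `<=` G].
  case: PG => // GE; exfalso; apply: (Gmax G0); last by right; split.
  have [a G0a] := abs0 0; rewrite GE; split; first exact: sub0set.
  by move/(_ _ G0a).
(* Adjoining [(- v, - a)] creates no point [(0, c)] with [c < 0], so by maximality the pair already
   belongs to [G]. *)
have add v a : (forall b, G (v, b) -> a <= b) -> G (- v, - a).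
  move=> ab.
  pose H : set (V * R) := [set q | exists t p,
    [/\ 0 <= t, G p & q = (p.1 - t *: v, p.2 - t * a)]].
  have [b G0b] := abs0 0.
  have [b' G0b'] := abs0 (- v).
  have Gz : G (0, 0).
    by have := GZ 0 _ (lexx _) (G0G _ G0b); rewrite scale0r mul0r.
  have GH : G `<=` H.
    move=> p Gp; exists 0, p; split => //.
    by rewrite scale0r mul0r !subr0 -surjective_pairing.
  have Hva : H (- v, - a).
    by exists 1, (0, 0); split => //=; rewrite scale1r mul1r !sub0r.
  apply: contrapT => nG; apply: (Gmax H).
    by split => // /(_ _ Hva).
  right; split; last by move=> q /G0G /GH.
    split.
      move=> _ _ [t [p [t0 Gp ->]]] [s [q [s0 Gq ->]]] /=.
      exists (t + s), (p.1 + q.1, p.2 + q.2); split; [exact: addr_ge0|exact: GD|].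
      by congr pair => /=; rewrite ?scalerDl ?mulrDl opprD addrACA.
    move=> s _ s0 [t [p [t0 Gp ->]]] /=.
    exists (s * t), (s *: p.1, s * p.2); split; [exact: mulr_ge0|exact: GZ|].
    by congr pair => /=; rewrite ?scalerBr ?scalerA ?mulrBr ?mulrA.
  move=> c [t [[k g] [t0 Gp]]] /= [/esym/eqP].
  rewrite subr_eq0 => /eqP kE ->.
  have [t00|tn0] := eqVneq t 0.
    rewrite t00 mul0r subr0; apply: posG.
    by rewrite kE t00 scale0r in Gp.
  have tp : 0 < t by rewrite lt_neqAle eq_sym tn0.
  have := GZ t^-1 _ (ltW (eq_ind_r is_true tp (invr_gt0 t))) Gp.
  rewrite /= kE scalerA mulVf // scale1r => /ab.
  by rewrite ler_pdivlMl // -subr_ge0.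
have ex v : exists a, G (v, a) /\ G (- v, - a).
  have [b G0b] := abs0 v.
  have [b' G0b'] := abs0 (- v).
  pose S := [set a | G (v, a)].
  have lbS : has_lbound S.
    exists (- b') => a Ga.
    have := posG (a + b'); have := GD _ _ Ga (G0G _ G0b').
    by rewrite /= subrr => h /(_ h) ?; lra.
  have neS : S !=set0 by exists b; exact: G0G.
  (* [add] is used twice: at [v] with the infimum of the admissible values, then at [- v] with its
     opposite. *)
  have Gm : G (- v, - inf S).
    by apply: add => c Gc; apply: ge_inf.
  exists (inf S); split => //.
  have := @add (- v) (- inf S); rewrite (opprK v) (opprK (inf S)); apply => c Gc.
  rewrite lerNl; apply: lb_le_inf => // a Ga.
  have := posG _ (eq_ind _ (fun w => G (w, a + c)) (GD _ _ Ga Gc) _ (subrr v)).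
  by move=> ?; lra.
have [xi xiP] := choice ex.
have le v a : G (v, a) -> xi v <= a.
  move=> Ga; have [_ G2] := xiP v.
  have := GD _ _ Ga G2; rewrite /= subrr => /posG.
  by rewrite subr_ge0.
have uniq v a : G (v, a) -> G (- v, - a) -> xi v = a.
  move=> G1 G2; apply/eqP; rewrite eq_le le //=.
  have [G3 _] := xiP v.
  have := GD _ _ G3 G2; rewrite /= subrr => /posG.
  by rewrite subr_ge0.
have xiZ a v : xi (a *: v) = a * xi v.
  have [G1 G2] := xiP v.
  have [a0|a0] := leP 0 a.
    apply: uniq; first exact: (GZ a _ a0 G1).
    by have := GZ a _ a0 G2; rewrite /= scalerN mulrN.
  have a0' : 0 <= - a by rewrite oppr_ge0 ltW.
  apply: uniq.
    by have := GZ (- a) _ a0' G2; rewrite /= scalerN scaleNr opprK mulrNN.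
  by have := GZ (- a) _ a0' G1; rewrite /= scaleNr mulNr.
exists xi; last by move=> v a /G0G; exact: le.
move=> a u v.
have [G1 G2] := xiP (a *: u); have [G3 G4] := xiP v.
rewrite (_ : a *: xi u = xi (a *: u)); last by rewrite xiZ.
apply: uniq; first exact: GD G1 G3.
by have := GD _ _ G2 G4; rewrite /= -!opprD.
Qed.

(** Apply the cone version to the sum of [G] and the epigraph of [M |.|]: by hypothesis this sum has
    no point [(0, a)] with [a < 0], and [(0, 0)] in [G] yields the norm bound. *)
Lemma hahn_banach_norm (V : normedModType R) (G : set (V * R)) (M : R) :
  cone G -> 0 <= M -> G !=set0 ->
  (forall k a, G (k, a) -> 0 <= a + M * `|k|) ->
  exists xi : V -> R^o,
    [/\ forall (a : R) u v, xi (a *: u + v) = a *: xi u + xi v,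
        forall v, `|xi v| <= M * `|v| &
        forall k a, G (k, a) -> xi k <= a].
Proof.
move=> [GD GZ] M0 [p Gp] posG.
have G00 : G (0, 0).
  by have := GZ 0 _ (lexx _) Gp; rewrite scale0r mul0r.
pose G0 : set (V * R) := [set q | exists k a,
  G (k, a) /\ a + M * `|q.1 - k| <= q.2].
have coneG0 : cone G0.
  split.
    move=> q r [k [a [Ga qa]]] [l [b [Gb rb]]] /=.
    exists (k + l), (a + b); split; first exact: (GD _ _ Ga Gb).
    apply: le_trans (lerD qa rb); rewrite /= addrACA lerD2l -mulrDr.
    rewrite ler_wpM2l // opprD addrACA; exact: ler_normD.
  move=> t q t0 [k [a [Ga qa]]] /=.
  exists (t *: k), (t * a); split; first exact: (GZ _ _ t0 Ga).
  rewrite /= -scalerBr normrZ ger0_norm // mulrCA -mulrDr.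
  exact: ler_wpM2l.
have [a [k [b [Gb]]]||xi linxi xiP] := @hahn_banach_cone V G0 coneG0.
- by rewrite /= sub0r normrN; apply: le_trans; exact: posG.
- by move=> v; exists (M * `|v|), 0, 0; split => //=; rewrite add0r subr0.
have xiM v : xi v <= M * `|v|.
  by apply: xiP; exists 0, 0; split => //=; rewrite add0r subr0.
exists xi; split => //.
  move=> v; rewrite ler_norml xiM andbT lerNl -(linN linxi).
  by rewrite -[`|v|]normrN.
by move=> k a Ga; apply: xiP; exists k, a; split => //=; rewrite subrr normr0 mulr0 addr0.
Qed.

End HahnBanach.

(** * Convex sets, convex hulls and closures *)

Section ConvexSets.
Variables (R : realType) (V : normedModType R).
Implicit Types (A C : set V).

Definition convex A : Prop := forall (l : R) u v,
  0 <= l <= 1 -> A u -> A v -> A (l *: u + (1 - l) *: v).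

(** This is behind the triangle inequality of gauges and the additivity of cones over a convex set:
    divide by [a + b], unless both coefficients vanish. *)
Lemma convex_addZ A a b u v : convex A -> 0 <= a -> 0 <= b -> A u -> A v ->
  exists2 w, A w & a *: u + b *: v = (a + b) *: w.
Proof.
move=> cA a0 b0 Au Av.
have [ab0|abn0] := eqVneq (a + b) 0.
  have /eqP := ab0; rewrite paddr_eq0 // => /andP[/eqP-> /eqP->].
  by exists u; rewrite // addr0 !scale0r addr0.
have abp : 0 < a + b by rewrite lt_neqAle eq_sym abn0 addr_ge0.
exists ((a / (a + b)) *: u + (1 - a / (a + b)) *: v).
  apply: cA => //; rewrite divr_ge0 ?(ltW abp) //=.
  by rewrite ler_pdivrMr // mul1r lerDl.
rewrite scalerDr !scalerA; congr (_ *: _ + _ *: _); first by rewrite mulrC divfK.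
by field.
Qed.

Lemma closureP_norm A y :
  closure A y <-> forall e : R, 0 < e -> exists2 a, A a & `|y - a| < e.
Proof.
split=> [cAy e e0|h B /nbhs_ballP[e /= e0 eB]].
  have [a [Aa]] := cAy _ (nbhsx_ballx y e e0).
  by rewrite -ball_normE; exists a.
have [a Aa ya] := h e e0.
by exists a; split => //; apply: eB; rewrite -ball_normE.
Qed.

Lemma conv_hull_sub A C : convex C -> C 0 -> A `<=` C -> conv_hull A `<=` C.
Proof.
move=> cC C0 AC _ [n [l [p [l0 [l1 [Ap ->]]]]]].
(* Stated for weights of arbitrary sum, the claim goes through by induction. *)
suff [w Cw ->] : exists2 w, C w & \sum_(i < n) l i *: p i = (\sum_(i < n) l i) *: w.
  by rewrite l1 scale1r.
elim: n => [|n IH] in l p l0 {l1} Ap *.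
  by exists 0; rewrite // !big_ord0 scaler0.
rewrite !big_ord_recl.
have [i|i|w Cw ->] := IH (fun i => l (lift ord0 i)) (fun i => p (lift ord0 i)).
- exact: l0.
- exact: Ap.
- apply: convex_addZ => //; last exact: AC.
  exact: sumr_ge0.
Qed.

Lemma conv_hull_convex A : convex (conv_hull A).
Proof.
move=> t _ _ /andP[t0 t1] [n [l [p [l0 [l1 [Ap ->]]]]]] [m [k [q [k0 [k1 [Aq ->]]]]]].
exists (n + m)%N,
  (fun i : 'I_(n + m) =>
     match fintype.split i with inl j => t * l j | inr j => (1 - t) * k j end),
  (fun i : 'I_(n + m) => match fintype.split i with inl j => p j | inr j => q j end).
split; first by move=> i; case: fintype.split => j; rewrite mulr_ge0 // subr_ge0.
split.
  rewrite big_split_ord /=.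
  under eq_bigr do rewrite (unsplitK (inl _)).
  under [X in _ + X]eq_bigr do rewrite (unsplitK (inr _)).
  by rewrite -!mulr_sumr l1 k1 !mulr1 addrC subrK.
split; first by move=> i; case: fintype.split.
rewrite big_split_ord /= !scaler_sumr; congr (_ + _); apply: eq_bigr => i _.
  by rewrite (unsplitK (inl _)) scalerA.
by rewrite (unsplitK (inr _)) scalerA.
Qed.

Lemma sub_conv_hull A : A `<=` conv_hull A.
Proof.
move=> y Ay; exists 1%N, (fun=> 1), (fun=> y).
by rewrite !big_ord1 scale1r.
Qed.

Lemma closure_convex A : convex A -> convex (closure A).
Proof.
move=> cA l u v l01 /closureP_norm Au /closureP_norm Av.
apply/closureP_norm => e e0.
have [u' Au' uu'] := Au _ e0; have [v' Av' vv'] := Av _ e0.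
exists (l *: u' + (1 - l) *: v'); first exact: cA.
have /andP[l0 l1] := l01.
rewrite opprD addrACA -!scalerBr (le_lt_trans (ler_normD _ _)) // !normrZ.
rewrite (ger0_norm l0) (@ger0_norm _ (1 - l)) ?subr_ge0 //.
have [->|ln0] := eqVneq l 0; first by rewrite mul0r add0r subr0 mul1r.
have lp : 0 < l by rewrite lt_neqAle eq_sym ln0.
have := ltr_pM2l lp `|u - u'| e; rewrite uu' => h1.
have : (1 - l) * `|v - v'| <= (1 - l) * e by rewrite ler_wpM2l ?subr_ge0 // ltW.
lra.
Qed.

Lemma closure_sub_closed A C : closed C -> A `<=` C -> closure A `<=` C.
Proof. by move=> clC AC y cAy; apply: clC; exact: closure_subset cAy. Qed.

Lemma closed_normP C :
  (forall y, (forall e : R, 0 < e -> exists2 a, C a & `|y - a| < e) -> C y) ->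
  closed C.
Proof. by move=> h y /closureP_norm /h. Qed.

Lemma closed_unit_ball : closed [set y : V | `|y| <= 1].
Proof.
apply: closed_normP => y h /=; apply/ler_addgt0Pr => e e0.
have [a /= a1 ya] := h e e0.
rewrite -(subrK a y) (le_trans (ler_normD _ _)) // addrC.
by rewrite lerD // ltW.
Qed.

Lemma unit_ball_convex : convex [set y : V | `|y| <= 1].
Proof.
move=> l u v /andP[l0 l1] /= u1 v1.
rewrite (le_trans (ler_normD _ _)) // !normrZ.
rewrite (ger0_norm l0) (@ger0_norm _ (1 - l)) ?subr_ge0 //.
have : l * `|u| <= l * 1 by rewrite ler_wpM2l.
have : (1 - l) * `|v| <= (1 - l) * 1 by rewrite ler_wpM2l ?subr_ge0.
lra.
Qed.

End ConvexSets.

(** * Extension, separation, finite rank coordinates and total boundedness *)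

Section NormedSpaces.
Variable R : realType.

(** Giving the densely defined map by its graph avoids a choice of representatives. The bound
    applied to differences makes the images of points tending to [v] a Cauchy filter; the final
    estimate contains both the extension property (take [v = p.1]) and continuity. *)
Lemma dense_graph_extension (V : normedModType R) (W : completeNormedModType R)
    (G : set (V * W)) (C : R) :
  0 <= C ->
  (forall a p q, G p -> G q -> G (a *: p.1 + q.1, a *: p.2 + q.2)) ->
  (forall p, G p -> `|p.2| <= C * `|p.1|) ->
  (forall v (e : R), 0 < e -> exists2 p, G p & `|v - p.1| < e) ->
  exists2 L : V -> W,
    (forall (a : R) u v, L (a *: u + v) = a *: L u + L v) &
    forall v p, G p -> `|L v - p.2| <= C * `|v - p.1|.
Proof.
move=> C0 Glin Gbnd Gdense.
have GB p q : G p -> G q -> `|p.2 - q.2| <= C * `|p.1 - q.1|.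
  move=> Gp Gq; have := Gbnd _ (Glin (-1) _ _ Gq Gp).
  by rewrite /= !scaleN1r ![- _ + _]addrC.
have ex v : exists w, forall p, G p -> `|w - p.2| <= C * `|v - p.1|.
  pose F : set_system W := [set A | exists2 e : R, 0 < e &
    forall p, G p -> `|v - p.1| < e -> A p.2].
  have FF : ProperFilter F.
    split.
      move=> [e e0 h]; have [p Gp pe] := Gdense v e e0; exact: h Gp pe.
    split.
    - by exists 1.
    - move=> A B [e e0 he] [d d0 hd]; exists (Num.min e d).
        by rewrite lt_min e0 d0.
      by move=> p Gp; rewrite lt_min => /andP[pe pd]; split; [exact: he|exact: hd].
    - by move=> A B AB [e e0 he]; exists e => // p Gp pe; apply: AB; exact: he.
  have Fc : cauchy F.
    apply: cauchy_exP => eps eps0.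
    pose e := eps / (2 * (C + 1)).
    have C1 : 0 < C + 1 by rewrite ltr_wpDl.
    have e0 : 0 < e by rewrite divr_gt0 // mulr_gt0.
    have [p Gp pe] := Gdense v e e0.
    exists p.2, e => // q Gq qe; rewrite -ball_normE /=.
    apply: le_lt_trans (GB _ _ Gp Gq) _.
    have pq : `|p.1 - q.1| < 2 * e.
      rewrite -(subrKA v) (le_lt_trans (ler_normD _ _)) //.
      by rewrite distrC mulr2n mulrDl mul1r ltrD.
    have -> : eps = (C + 1) * (2 * e) by rewrite /e; field; exact: lt0r_neq0.
    rewrite (le_lt_trans (ler_wpM2l C0 (ltW pq))) // ltr_pM2r ?ltrDl //.
    by rewrite mulr_gt0.
  have Fcv : cvg F by exact: cauchy_cvg.
  pose w : W := lim F.
  have Fw : F --> w by exact: Fcv.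
  exists w => p Gp; apply/ler_addgt0Pl => eps eps0.
  pose e1 := eps / (C + 1).
  have C1 : 0 < C + 1 by rewrite ltr_wpDl.
  have e10 : 0 < e1 by rewrite divr_gt0.
  have [e e0 he] : F (ball w e1) by apply: Fw; exact: nbhsx_ballx.
  have ee1 : 0 < Num.min e e1 by rewrite lt_min e0.
  have [q Gq] := Gdense v _ ee1.
  rewrite lt_min => /andP[qe qe1].
  have := he q Gq qe; rewrite -ball_normE /= => wq.
  rewrite -(subrKA q.2) (le_trans (ler_normD _ _)) //.
  have qp : `|q.1 - p.1| <= e1 + `|v - p.1|.
    by rewrite -(subrKA v) (le_trans (ler_normD _ _)) // lerD2r distrC ltW.
  have := le_trans (GB _ _ Gq Gp) (ler_wpM2l C0 qp).
  have -> : eps = e1 + C * e1 by rewrite /e1; field; exact: lt0r_neq0.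
  by rewrite mulrDr -addrA => h; apply: lerD => //; exact: ltW.
have [L LP] := choice ex.
exists L => // a u v; apply/eqP; rewrite -subr_eq0 -normr_le0.
apply/ler_addgt0Pr => eps eps0; rewrite add0r.
(* Approximating [u] and [v] within [e] costs [C (|a| + 1) e] on each side of the linearity
   identity. *)
pose K := 2 * C * (`|a| + 1).
have K0 : 0 <= K by rewrite !mulr_ge0.
pose e := eps / (K + 1).
have K1 : 0 < K + 1 by rewrite ltr_wpDl.
have e0 : 0 < e by rewrite divr_gt0.
have [p Gp pe] := Gdense u e e0.
have [q Gq qe] := Gdense v e e0.
have h1 := LP _ _ (Glin a _ _ Gp Gq); rewrite /= in h1.
have {}h1 : `|L (a *: u + v) - (a *: p.2 + q.2)| <= C * ((`|a| + 1) * e).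
  apply: le_trans (h1 _) _; rewrite ler_wpM2l // opprD addrACA -scalerBr.
  rewrite (le_trans (ler_normD _ _)) // normrZ mulrDl mul1r.
  by rewrite lerD ?ler_wpM2l // ltW.
have h2 : `|a *: (p.2 - L u) + (q.2 - L v)| <= C * ((`|a| + 1) * e).
  rewrite (le_trans (ler_normD _ _)) // normrZ mulrDl mul1r mulrDr mulrCA.
  rewrite lerD //; first rewrite ler_wpM2l //.
    by rewrite distrC (le_trans (LP _ _ Gp)) // ler_wpM2l // ltW.
  by rewrite distrC (le_trans (LP _ _ Gq)) // ler_wpM2l // ltW.
have -> : L (a *: u + v) - (a *: L u + L v) =
  (L (a *: u + v) - (a *: p.2 + q.2)) + (a *: (p.2 - L u) + (q.2 - L v)).
  by rewrite scalerBr (addrACA (a *: p.2)) -opprD addrA subrK.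
rewrite (le_trans (ler_normD _ _)) // (le_trans (lerD h1 h2)) //.
have -> : C * ((`|a| + 1) * e) + C * ((`|a| + 1) * e) = K * e.
  by rewrite /K; ring.
have -> : eps = (K + 1) * e by rewrite /e; field; exact: lt0r_neq0.
by rewrite mulrDl lerDl mul1r ltW.
Qed.

(** Hahn-Banach for the cone generated by the pairs [(u, 1)], [u] in [U], and [(- y, - L)]. As [U]
    is closed, [y] has distance at least some [d > 0] from [L U], which allows the norm bound
    [L / d]. *)
Lemma convex_separation (V : normedModType R) (U : set V) (y : V) (L : R) :
  closed U -> U 0 -> convex U -> 0 < L ->
  ~ (exists u, U u /\ y = L *: u) ->
  exists (M : R) (xi : V -> R^o),
    [/\ forall (a : R) u v, xi (a *: u + v) = a *: xi u + xi v,
        forall v, `|xi v| <= M * `|v|,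
        forall u, U u -> xi u <= 1 & L <= xi y].
Proof.
move=> clU U0 convU L0 nU.
have [d d0 dist] : exists2 d, 0 < d & forall u, U u -> d <= `|L *: u - y|.
  have nUy : ~ U (L^-1 *: y).
    move=> Uy; apply: nU; exists (L^-1 *: y); split => //.
    by rewrite scalerA mulfV ?scale1r // lt0r_neq0.
  have [e /= e0 eU] : exists2 e, 0 < e & forall u, U u -> e <= `|L^-1 *: y - u|.
    have : nbhs (L^-1 *: y) (~` U) by apply: open_nbhs_nbhs; split => //; exact: closed_openC.
    move=> /nbhs_ballP[e /= e0 eU]; exists e => // u Uu.
    rewrite leNgt; apply/negP => h; apply: (eU u) => //.
    by rewrite -ball_normE.
  exists (L * e); first exact: mulr_gt0.
  move=> u Uu; have -> : L *: u - y = L *: (u - L^-1 *: y).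
    by rewrite scalerBr scalerA mulfV ?scale1r // lt0r_neq0.
  by rewrite normrZ gtr0_norm // ler_pM2l // distrC eU.
pose G : set (V * R) := [set p | exists l t u,
  [/\ 0 <= l, 0 <= t, U u & p = (l *: u - t *: y, l - t * L)]].
have U_scale l u : 0 <= l <= 1 -> U u -> U (l *: u).
  by move=> l01 Uu; have := convU l u 0 l01 Uu U0; rewrite scaler0 addr0.
have coneG : cone G.
  split.
    move=> _ _ [l [t [u [l0 t0 Uu ->]]]] [k [s [v [k0 s0 Uv ->]]]] /=.
    have [w Uw wE] := convex_addZ convU l0 k0 Uu Uv.
    exists (l + k), (t + s), w; split=> //; [exact: addr_ge0|exact: addr_ge0|].
    congr pair; last by rewrite mulrDl; ring.
    by rewrite addrACA wE -opprD -scalerDl.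
  move=> a _ a0 [l [t [u [l0 t0 Uu ->]]]] /=.
  exists (a * l), (a * t), u; split; [exact: mulr_ge0|exact: mulr_ge0|done|].
  by congr pair; rewrite ?scalerBr ?scalerA // mulrBr mulrA.
have Md : 0 <= L / d by rewrite divr_ge0 // ltW.
have [||xi [linxi xiM xiG]] := @hahn_banach_norm _ V G (L / d) coneG Md.
- by exists (0 *: 0 - 0 *: y, 0 - 0 * L), 0, 0, 0; split.
- move=> k a [l [t [u [l0 t0 Uu]]]] [-> ->].
  have [t00|tn0] := eqVneq t 0.
    by rewrite t00 mul0r subr0 addr_ge0 // mulr_ge0.
  have tp : 0 < t by rewrite lt_neqAle eq_sym tn0.
  have [tLl|ltL] := leP (t * L) l.
    by rewrite addr_ge0 ?subr_ge0 // mulr_ge0.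
  (* Here [l < t L], so [(l / (t L)) u] stays in [U] because [0] lies in [U], and the vector has
     norm at least [t d]. *)
  have -> : l *: u - t *: y = t *: (L *: ((l / (t * L)) *: u) - y).
    rewrite scalerBr !scalerA; congr (_ *: _ - _); field.
    by rewrite !lt0r_neq0.
  have tL : 0 < t * L by rewrite mulr_gt0.
  have Ulu : U ((l / (t * L)) *: u).
    by apply: U_scale => //; rewrite divr_ge0 ?(ltW tL) //= ler_pdivrMr // mul1r ltW.
  have := dist _ Ulu; set N := `| L *: _ - _|; move=> dN.
  rewrite normrZ gtr0_norm //.
  have : t * L <= L / d * (t * N).
    rewrite [leRHS](_ : _ = t * L * (N / d)); last by field; exact: lt0r_neq0.
    by rewrite ler_peMr ?(ltW tL) // ler_pdivlMr // mul1r.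
  by rewrite -/N; lra.
exists (L / d), xi; split => //.
  move=> u Uu; apply: xiG; exists 1, 0, u; split => //.
  by rewrite scale1r scale0r mul0r !subr0.
have : xi (- y) <= - L.
  by apply: xiG; exists 0, 1, 0; split => //; rewrite scaler0 scale1r mul1r !sub0r.
by rewrite (linN linxi) lerN2.
Qed.

Lemma norming_functional (V : normedModType R) (v : V) : v != 0 ->
  exists xi : V -> R^o, [/\ bounded_linear xi & xi v = 1].
Proof.
move=> v0; have nv : 0 < `|v| by rewrite normr_gt0.
(* Constraints for both signs of [t] force [xi v = 1]. *)
pose G : set (V * R) := [set p | exists t : R, p = (t *: v, t)].
have coneG : cone G.
  split; first by move=> _ _ [t ->] [s ->] /=; exists (t + s); rewrite scalerDl.
  by move=> a _ _ [t ->] /=; exists (a * t); rewrite scalerA.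
have Mv : 0 <= `|v|^-1 by rewrite invr_ge0.
have [||xi [linxi xiM xiG]] := @hahn_banach_norm _ V G `|v|^-1 coneG Mv.
- by exists (0 *: v, 0), 0.
- move=> k a [t [-> ->]]; rewrite normrZ mulrCA mulVf ?mulr1 ?lt0r_neq0 //.
  by rewrite -lerBlDl sub0r ler_normr lexx orbT.
exists xi; split; first by split=> //; exists `|v|^-1.
apply/eqP; rewrite eq_le xiG; last by exists 1; rewrite scale1r.
rewrite -lerN2 -(linN linxi); apply: xiG.
by exists (-1); rewrite scaleN1r.
Qed.

(* Each step splits off the rank one map [v |-> g (T v) *: T v0], with
   [g (T v0) = 1]; what remains takes its values in [ker g]. *)
Lemma finite_rank_coordinates (V W : normedModType R) (T : V -> W) :
  finite_rank T ->
  exists (m : nat) (phi : nat -> V -> R^o) (w : nat -> W),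
    (forall i, bounded_linear (phi i)) /\
    forall v, T v = \sum_(i < m) phi i v *: w i.
Proof.
move=> [bT [n [w]]]; elim: n => [|n IH] in T bT w *.
  move=> Tw; exists 0, (fun _ _ => 0), (fun=> 0); split.
    by move=> _; split=> [a u v|]; [rewrite scaler0 addr0|exists 0 => v; rewrite normr0 mul0r].
  by move=> v; have [c ->] := Tw v; rewrite !big_ord0.
move=> Tw.
have [[v0 /eqP Tv0]|T0] := pselect (exists v, T v <> 0); last first.
  exists 0, (fun _ _ => 0), (fun=> 0); split.
    by move=> _; split=> [a u v|]; [rewrite scaler0 addr0|exists 0 => v; rewrite normr0 mul0r].
  by move=> v; rewrite big_ord0; apply: contrapT => Tv; apply: T0; exists v.
have [g [[ling [Mg gM]] gv0]] := norming_functional Tv0.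
have [linT [MT TM]] := bT.
have lingT (a : R) u v : g (T (a *: u + v)) = a *: g (T u) + g (T v).
  by rewrite linT ling.
have bgT : bounded_linear (g \o T).
  split=> //; exists (`|Mg| * MT) => v /=.
  rewrite (le_trans (gM _)) // (@le_trans _ _ (`|Mg| * `|T v|)) //.
    by rewrite ler_wpM2r // ler_norm.
  by rewrite -mulrA ler_wpM2l.
pose T' v := T v - g (T v) *: T v0.
have bT' : bounded_linear T'.
  split.
    move=> a u v; rewrite /T' lingT linT scalerDl scalerBr opprD addrACA.
    by rewrite scalerA.
  have [_ [M gTM]] := bgT.
  exists (MT + M * `|T v0|) => v; rewrite (le_trans (ler_normB _ _)) //.
  rewrite mulrDl lerD // normrZ mulrAC ler_wpM2r //; exact: gTM.
have gT' v : g (T' v) = 0.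
  by rewrite (linB ling) (linZ ling) gv0 /GRing.scale /= mulr1 subrr.
(* Some [w i] lies outside [ker g]; projecting the others along it onto [ker g] leaves [n] vectors
   whose span contains the range of [T']. *)
have [i gi] : exists i, g (w i) != 0.
  apply: contrapT => h; have [c Tc] := Tw v0.
  have : g (T v0) = 0.
    rewrite Tc (lin_sum ling) big1 // => i _; rewrite (linZ ling).
    apply/eqP; rewrite scaler_eq0; apply/orP; right; apply/negPn/negP => h'.
    by apply: h; exists i.
  by rewrite gv0 => /eqP; rewrite oner_eq0.
have [c0 Tc0] := Tw v0.
have [|m [phi [w' [bphi Tphi]]]] := IH T' bT'
  (fun j => w (lift i j) - (g (w (lift i j)) / g (w i)) *: w i).
- move=> v; have [c1 Tc1] := Tw v.
  pose c j := c1 j - g (T v) * c0 j.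
  have Tc : T' v = \sum_j c j *: w j.
    rewrite /T' Tc0 {1}Tc1 scaler_sumr -sumrB; apply: eq_bigr => j _.
    by rewrite scalerA -scalerBl.
  exists (fun j => c (lift i j)).
  have S0 : \sum_j c j *: g (w j) = 0 :> R^o.
    rewrite -[RHS](gT' v) Tc (lin_sum ling); apply: eq_bigr => j _.
    by rewrite (linZ ling).
  have ci : c i * g (w i) = - \sum_(j < n) c (lift i j) * g (w (lift i j)).
    by apply/eqP; rewrite -addr_eq0; rewrite (bigD1_ord i) //= in S0; apply/eqP.
  rewrite Tc (bigD1_ord i) //=.
  have -> : c i = - (\sum_(j < n) c (lift i j) * g (w (lift i j))) / g (w i).
    by rewrite -ci mulfK.
  under [RHS]eq_bigr do rewrite scalerBr scalerA mulrA.
  rewrite sumrB addrC mulNr scaleNr; congr (_ - _).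
  by rewrite mulr_suml scaler_suml.
- exists m.+1, (fun k => if k is k'.+1 then phi k' else g \o T),
    (fun k => if k is k'.+1 then w' k' else T v0); split.
    by case=> [|k].
  by move=> v; rewrite big_ord_recl /= -Tphi addrC subrK.
Qed.

(** An ultrafilter on the closure contains one cell of each finite cover, so it is Cauchy, and
    completeness gives a limit. *)
Lemma totally_bounded_precompact (V : completeNormedModType R) (A : set V) :
  (forall e : R, 0 < e -> exists (N : nat) (B : nat -> set V),
    (forall y, A y -> exists2 i, (i < N)%N & B i y) /\
    forall i y y', B i y -> B i y' -> `|y - y'| <= e) ->
  compact (closure A).
Proof.
move=> tb; rewrite compact_ultra => F UF FA.
have FF : ProperFilter F := @ultra_proper _ _ UF.
have Fc : cauchy F.
  apply: cauchy_exP => eps eps0.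
  have e0 : 0 < eps / 4 by rewrite divr_gt0.
  have [N [B [AB Bd]]] := tb _ e0.
  (* Thickening the cells by [eps / 4] makes them cover the closure of [A]. *)
  pose B' i := [set y | exists2 b, B i b & `|y - b| < eps / 4].
  have AB' : closure A `<=` [set y | exists2 i, (i < N)%N & B' i y].
    move=> y /(_ _ (nbhsx_ballx y _ e0))[b [Ab]].
    rewrite -ball_normE /= => yb; have [i iN Bib] := AB _ Ab.
    by exists i => //; exists b.
  have {AB'}FU : F [set y | exists2 i, (i < N)%N & B' i y].
    by apply: filterS AB' FA.
  have [i FBi] : exists i, F (B' i).
    elim: N {AB} FU => [|N IH] FU.
      by exfalso; apply: (@filter_not_empty _ F); apply: filterS FU => y [].
    have [FN|FN] := in_ultra_setVsetC (B' N) UF; first by exists N.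
    apply: IH; apply: filterS (filterI FU FN) => y [[i iN Biy] nN].
    exists i => //; rewrite ltn_neqAle -ltnS iN andbT.
    by apply/eqP => iNE; apply: nN; rewrite iNE in Biy.
  have [y [b Bb yb]] := filter_ex FBi.
  exists b; apply: filterS FBi => z [b' Bb' zb'].
  rewrite -ball_normE /= -(subrKA b') (le_lt_trans (ler_normD _ _)) //.
  have := Bd _ _ _ Bb Bb'; rewrite [`|b' - z|]distrC; lra.
have Fcv : cvg F by exact: cauchy_cvg.
exists (lim F); split => //; apply: closed_closure => B /Fcv FB.
exact: (filter_ex (filterI FA FB)).
Qed.

End NormedSpaces.

(** * The sets [U_t], their gauges and the compactness of their inclusions *)

Section WillisBalls.
Variables (R : realType) (X : normedModType R) (x : nat -> X).
Hypothesis x01 : forall n, 0 < `|x n| <= 1.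

Let e (t : R) n := (`|x n| `^ t)^-1 *: x n.

Let xgt0 n : 0 < `|x n|. Proof. by have /andP[] := x01 n. Qed.

Lemma U_closed t : closed (U_t x t).
Proof. exact: closed_closure. Qed.

Lemma U_convex t : convex (U_t x t).
Proof. exact/closure_convex/conv_hull_convex. Qed.

Lemma U_gen t n : U_t x t (e t n) /\ U_t x t (- e t n).
Proof.
by split; apply: subset_closure; apply: sub_conv_hull; exists n; [left|right].
Qed.

Lemma U0 t : U_t x t 0.
Proof.
have h : 0 <= (2^-1 : R) <= 1 by apply/andP; split; lra.
have [U1 U2] := U_gen t 0.
have := U_convex h U1 U2; rewrite scalerN.
by rewrite (_ : 1 - 2^-1 = 2^-1) ?subrr //; lra.
Qed.

Lemma U_sub t C : closed C -> convex C -> C 0 ->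
  (forall n, C (e t n)) -> (forall n, C (- e t n)) -> U_t x t `<=` C.
Proof.
move=> clC cC C0 Ce CNe; apply: closure_sub_closed => //.
apply: conv_hull_sub => // y [n [->|->]]; [exact: Ce|exact: CNe].
Qed.

Lemma U_opp t u : U_t x t u -> U_t x t (- u).
Proof.
pose C := [set y | U_t x t (- y)].
suff : U_t x t `<=` C by move=> h /h.
apply: U_sub.
- apply: closed_normP => y h; apply/(@U_closed t)/closureP_norm => d d0.
  have [a Ca ya] := h d d0; exists (- a) => //.
  by rewrite -opprD normrN.
- move=> l y z l01 Cy Cz; rewrite /C /= opprD -!scalerN.
  exact: U_convex.
- by rewrite /C /= oppr0; exact: U0.
- by move=> n; exact: (U_gen t n).2.
- by move=> n; rewrite /C /= opprK; exact: (U_gen t n).1.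
Qed.

Lemma U_norm t u : t <= 1 -> U_t x t u -> `|u| <= 1.
Proof.
move=> t1; have ne n : `|e t n| <= 1.
  rewrite normrZ ger0_norm ?invr_ge0 ?powR_ge0 //.
  have := xgt0 n; have /andP[_ x1] := x01 n => x0.
  rewrite mulrC ler_pdivrMr ?powR_gt0 // mul1r.
  exact: ger1_powR.
suff : U_t x t `<=` [set y | `|y| <= 1] by move=> h /h.
apply: U_sub => //; [exact: closed_unit_ball|exact: unit_ball_convex| |].
  by rewrite /= normr0.
by move=> n; rewrite /= normrN.
Qed.

(** Membership in [l U_t]: a substitute for [norm_t <= l] without infima or extended reals. *)
Definition gauge_le t l y : Prop := exists u, U_t x t u /\ y = l *: u.

Lemma gauge_le0 t l : gauge_le t l 0.
Proof. by exists 0; split; [exact: U0|rewrite scaler0]. Qed.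

Lemma gauge_leU t u : U_t x t u -> gauge_le t 1 u.
Proof. by exists u; rewrite scale1r. Qed.

Lemma gauge_le1 t u : gauge_le t 1 u -> U_t x t u.
Proof. by move=> [v [Uv ->]]; rewrite scale1r. Qed.

Lemma gauge_leD t l m y z : 0 <= l -> 0 <= m ->
  gauge_le t l y -> gauge_le t m z -> gauge_le t (l + m) (y + z).
Proof.
move=> l0 m0 [u [Uu ->]] [v [Uv ->]].
by have [w Uw ->] := convex_addZ (@U_convex t) l0 m0 Uu Uv; exists w.
Qed.

Lemma gauge_leW t l m y : 0 <= l <= m -> gauge_le t l y -> gauge_le t m y.
Proof.
move=> /andP[l0 lm] ly; have ml : 0 <= m - l by rewrite subr_ge0.
by have := gauge_leD l0 ml ly (gauge_le0 _ _); rewrite addr0 addrC subrK.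
Qed.

Lemma gauge_leN t l y : gauge_le t l y -> gauge_le t l (- y).
Proof.
by move=> [u [Uu ->]]; exists (- u); rewrite scalerN; split=> //; exact: U_opp.
Qed.

Lemma gauge_leZ t a l y : gauge_le t l y -> gauge_le t (`|a| * l) (a *: y).
Proof.
move=> [u [Uu ->]]; have [a0|a0] := leP 0 a.
  by exists u; rewrite scalerA ger0_norm.
exists (- u); split; first exact: U_opp.
by rewrite scalerA scalerN ltr0_norm // mulNr scaleNr opprK.
Qed.

Lemma gauge_le_norm t l y : t <= 1 -> 0 <= l -> gauge_le t l y -> `|y| <= l.
Proof.
move=> t1 l0 [u [Uu ->]]; rewrite normrZ ger0_norm //.
by rewrite ler_piMr // (U_norm t1).
Qed.

Lemma gauge_le_closed t l y : 0 < l ->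
  (forall d : R, 0 < d -> exists2 z, gauge_le t l z & `|y - z| < d) ->
  gauge_le t l y.
Proof.
move=> l0 h; have ln0 := lt0r_neq0 l0.
exists (l^-1 *: y); rewrite scalerA mulfV // scale1r; split=> //.
apply/(@U_closed t)/closureP_norm => d d0.
have [_ [u [Uu ->]] yu] := h _ (mulr_gt0 l0 d0).
exists u => //; rewrite -(ltr_pM2l l0) -[X in X * `|_ - _|](gtr0_norm l0) -normrZ.
by rewrite scalerBr scalerA mulfV // scale1r.
Qed.

(** The factor [|x_n|^(t - s)] governs how [U_s] sits in [U_t]: it is at most [1] for [s <= t],
    which gives monotonicity, and tends to [0] for [s < t], which gives compactness. *)
Lemma gen_powR s t n : e s n = `|x n| `^ (t - s) *: e t n.
Proof.
rewrite /e scalerA; congr (_ *: _).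
have h : `|x n| != 0 by rewrite lt0r_neq0.
rewrite powRB ?h ?implybT // mulrAC divff ?mul1r //.
by rewrite lt0r_neq0 // powR_gt0.
Qed.

Lemma gauge_le_gen s t n l : `|x n| `^ (t - s) <= l -> gauge_le t l (e s n).
Proof.
move=> h; apply: (@gauge_leW _ (`|x n| `^ (t - s))); first by rewrite powR_ge0.
by rewrite (@gen_powR s t); exists (e t n); split=> //; exact: (U_gen t n).1.
Qed.

Lemma U_mono s t : s <= t -> U_t x s `<=` U_t x t.
Proof.
move=> st.
have h n : U_t x t (e s n).
  apply/gauge_le1/gauge_le_gen.
  rewrite -(powRr0 `|x n|); apply: ger_powR => //.
  by rewrite subr_ge0.
apply: U_sub => //; [exact: U_closed|exact: U_convex|exact: U0|].
by move=> n; apply: U_opp.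
Qed.

Lemma gauge_le_mono s t l y : s <= t -> gauge_le s l y -> gauge_le t l y.
Proof. by move=> st [u [Uu ->]]; exists u; split=> //; exact: U_mono Uu. Qed.

(** Convexity and symmetry of [U_t] absorb a linear combination into a single multiple of [U_t]. *)
Lemma Y_gauge t y : Y_t x t y <-> exists2 l, 0 < l & gauge_le t l y.
Proof.
split=> [[n [a [p [Up ->]]]]|[l l0 [u [Uu ->]]]]; last first.
  by exists 1%N, (fun=> l), (fun=> u); rewrite big_ord1.
elim: n => [|n IH] in a p Up *.
  by exists 1; rewrite // big_ord0; exact: gauge_le0.
have [i|l l0 lS] := IH (fun i => a (lift ord0 i)) (fun i => p (lift ord0 i)).
  exact: Up.
exists (`|a ord0| * 1 + l); first by rewrite ltr_wpDl // mulr1.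
rewrite big_ord_recl; apply: gauge_leD => //; [by exact: ltW|].
by apply: gauge_leZ; exact: gauge_leU.
Qed.

Lemma Y_lin t a y z : Y_t x t y -> Y_t x t z -> Y_t x t (a *: y + z).
Proof.
move=> /Y_gauge[l l0 ly] /Y_gauge[m m0 mz]; apply/Y_gauge.
exists (`|a| * l + m); first by rewrite ltr_wpDl // mulr_ge0 // ltW.
apply: gauge_leD => //; [by rewrite mulr_ge0 // ltW|exact: ltW|exact: gauge_leZ].
Qed.

Lemma Y_mono s t : s <= t -> Y_t x s `<=` Y_t x t.
Proof.
move=> st y /Y_gauge[l l0 ly]; apply/Y_gauge; exists l => //.
exact: gauge_le_mono ly.
Qed.

Lemma U_Y t u : U_t x t u -> Y_t x t u.
Proof. by move=> Uu; apply/Y_gauge; exists 1 => //; exact: gauge_leU. Qed.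

(** Total boundedness for the gauge of [U_t]; the list [ps] is a finite net. *)
Definition gauge_precompact t (A : set X) : Prop := forall d : R, 0 < d ->
  exists ps : seq X, forall k, A k -> exists2 p, p \in ps & gauge_le t d (k - p).

Lemma gauge_precompactD t A B : gauge_precompact t A -> gauge_precompact t B ->
  gauge_precompact t [set a + b | a in A & b in B].
Proof.
move=> pA pB d d0; have d2 : 0 < d / 2 by rewrite divr_gt0.
have [ps hA] := pA _ d2; have [qs hB] := pB _ d2.
exists [seq p + q | p <- ps, q <- qs] => _ [a Aa [b Bb <-]].
have [p pps ap] := hA _ Aa; have [q qqs bq] := hB _ Bb.
exists (p + q); first by apply/allpairsP; exists (p, q).
by rewrite opprD addrACA (splitr d); apply: gauge_leD => //; exact: ltW.
Qed.

Lemma gauge_precompact_segment t u : U_t x t u ->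
  gauge_precompact t [set l *: u | l in [set l : R | `|l| <= 1]].
Proof.
move=> Uu d d0.
have di : 0 <= d^-1 by rewrite invr_ge0 ltW.
(* As [1 / Q < d], the multiples of [1 / Q] in [[-1, 1]] form a net; [i] below selects the grid
   point just under [l]. *)
pose Q := (Num.bound d^-1).
have Qd : d^-1 < Q%:R by exact: archi_boundP.
have Q0 : 0 < Q%:R :> R by exact: le_lt_trans Qd.
exists [seq ((i%:R - Q%:R) / Q%:R) *: u | i <- iota 0 (2 * Q).+1] => _ [l l1 <-].
rewrite /mkset in l1.
have /andP[l2 l3] : - 1 <= l <= 1 by rewrite -ler_norml.
have lQ : 0 <= (l + 1) * Q%:R by rewrite mulr_ge0 // ?(ltW Q0) //; lra.
have /andP[i1 i2] := truncn_itv lQ.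
set i := Num.trunc _ in i1 i2.
exists (((i%:R - Q%:R) / Q%:R) *: u).
  apply/mapP; exists i => //; rewrite mem_iota /= add0n ltnS -(ler_nat R).
  apply: le_trans i1 _; rewrite natrM ler_pM2r //; lra.
rewrite -scalerBl; apply: (@gauge_leW _ (l - (i%:R - Q%:R) / Q%:R)); last by exists u.
have QE : Q%:R != 0 :> R by rewrite lt0r_neq0.
have -> : l - (i%:R - Q%:R) / Q%:R = ((l + 1) * Q%:R - i%:R) / Q%:R by field.
rewrite divr_ge0 ?subr_ge0 ?(ltW Q0) //= ler_pdivrMr //.
have : 1 <= d * Q%:R by rewrite -ler_pdivrMl // mulr1 ltW.
by move: i2; rewrite -natr1; lra.
Qed.

Hypothesis x_cvg0 : (fun n => `|x n|) @ \oo --> (0 : R).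

Lemma powR_x_cvg0 (r d : R) : 0 < r -> 0 < d ->
  exists N, forall n, (N <= n)%N -> `|x n| `^ r <= d.
Proof.
move=> r0 d0.
have d'0 : 0 < d `^ r^-1 by rewrite powR_gt0.
have [N _ hN] := (@cvgrPdist_lt R R _ _ _ _ _).1 x_cvg0 _ d'0.
exists N => n /hN /=; rewrite sub0r normrN normr_id => /ltW xd.
have -> : d = (d `^ r^-1) `^ r.
  by rewrite -powRrM mulVf ?lt0r_neq0 // powRr1 // ltW.
by apply: ge0_ler_powR; rewrite ?nnegrE ?(ltW r0) ?powR_ge0.
Qed.

(** The Minkowski sum of the segments from [- e s n] to [e s n], [n < N]: a convex set containing
    the first generators and their negatives, whose total boundedness follows by induction. *)
Fixpoint head_cube (s : R) (N : nat) : set X :=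
  if N is N'.+1 then
    [set a + b | a in head_cube s N' & b in [set l *: e s N' | l in [set l : R | `|l| <= 1]]]
  else [set 0].

Lemma segment_convex (u : X) :
  convex [set l *: u | l in [set l : R | `|l| <= 1]].
Proof.
move=> t _ _ /andP[t0 t1] [l /= l1 <-] [m m1 <-].
exists (t * l + (1 - t) * m); last by rewrite scalerDl !scalerA.
have := @unit_ball_convex R (R : normedModType R) t l m; apply => //.
by rewrite t0.
Qed.

Lemma sum_convex (A B : set X) : convex A -> convex B ->
  convex [set a + b | a in A & b in B].
Proof.
move=> cA cB t _ _ t01 [a Aa [b Bb <-]] [c Ac [d Bd <-]].
exists (t *: a + (1 - t) *: c); first exact: cA.
exists (t *: b + (1 - t) *: d); first exact: cB.
by rewrite !scalerDr addrACA.
Qed.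

Lemma head_cubeP s N : [/\ convex (head_cube s N), head_cube s N 0 &
  forall n (b : bool), (n < N)%N -> head_cube s N ((-1) ^+ b *: e s n)].
Proof.
have seg0 n : [set l *: e s n | l in [set l : R | `|l| <= 1]] 0.
  exists 0; last by rewrite scale0r.
  by rewrite /= normr0.
elim: N => [|N [cN hN0 hN]] /=.
  split=> //.
  by move=> l u v _ /= -> ->; rewrite !scaler0 addr0.
split.
- apply: sum_convex => //; exact: segment_convex.
- by exists 0 => //; exists 0; [exact: seg0|rewrite addr0].
move=> n b; rewrite ltnS leq_eqVlt => /orP[/eqP->|nN].
  exists 0 => //; exists ((-1) ^+ b *: e s N); last by rewrite add0r.
  exists ((-1) ^+ b) => //.
  by rewrite /= normrX normrN1 expr1n.
exists ((-1) ^+ b *: e s n); first exact: hN.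
by exists 0; [exact: seg0|rewrite addr0].
Qed.

Lemma head_cube_precompact s t N : s <= t -> gauge_precompact t (head_cube s N).
Proof.
move=> st; elim: N => [|N IH] /=.
  move=> d d0; exists [:: 0] => _ ->; exists 0; rewrite ?inE // subrr.
  exact: gauge_le0.
apply: gauge_precompactD => //; apply: gauge_precompact_segment.
exact: (U_mono st (U_gen s N).1).
Qed.

(* The inclusion of [Y_s] into [Y_t] is compact: up to [d / 2] in the gauge of
   [U_t] only finitely many of the generators of [U_s] matter. *)
Lemma U_precompact s t : s < t -> gauge_precompact t (U_t x s).
Proof.
move=> st d d0; have d2 : 0 < d / 2 by rewrite divr_gt0.
have ts : 0 < t - s by rewrite subr_gt0.
have [N hN] := powR_x_cvg0 ts d2.
have [cN hN0 hNe] := head_cubeP s N.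
have [ps hps] := @head_cube_precompact s t N (ltW st) _ d2.
exists ps.
(* The generators and their negatives lie in the convex set [D]; [D] is contained in the finite
   union [C] of translates of [d U_t]; and [C] is closed, so it contains the closed hull. *)
pose C := [set k | exists2 p, p \in ps & gauge_le t d (k - p)].
pose D := [set a + b | a in head_cube s N & b in [set b | gauge_le t (d / 2) b]].
have clC : closed C.
  rewrite {}/C {hps}; elim: ps => [|p ps IH].
    rewrite (_ : [set _ | _] = set0); first exact: closed0.
    by apply/seteqP; split=> // k [].
  rewrite (_ : [set _ | _] = [set k | gauge_le t d (k - p)] `|`
      [set k | exists2 p, p \in ps & gauge_le t d (k - p)]); last first.
    apply/seteqP; split=> k /=.
      by move=> [q]; rewrite inE => /orP[/eqP->|qps] kq; [left|right; exists q].
    move=> [kp|[q qps kq]]; first by exists p; rewrite ?inE ?eqxx.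
    by exists q; rewrite // inE qps orbT.
  apply: closedU => //; apply: closed_normP => y h; apply: gauge_le_closed => // r r0.
  have [a /= ap ya] := h _ r0; exists (a - p) => //.
  by rewrite opprB addrA subrK.
have DC : D `<=` C.
  move=> _ [a /hps[p pps ap] [b bd <-]]; exists p => //.
  by rewrite addrAC (splitr d); apply: gauge_leD => //; exact: ltW.
suff : U_t x s `<=` C by move=> h k /h.
apply: closure_sub_closed => //.
apply: subset_trans DC; apply: conv_hull_sub.
- apply: sum_convex => // l _ _ l01 [u [Uu ->]] [v [Uv ->]].
  exists (l *: u + (1 - l) *: v); split; first exact: U_convex.
  by rewrite scalerDr !scalerA ![_ * (d / 2)]mulrC.
- by exists 0 => //; exists 0; rewrite ?addr0 //; exact: gauge_le0.
move=> y [n ny].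
have [b ->] : exists b : bool, y = (-1) ^+ b *: e s n.
  by case: ny => ->; [exists false; rewrite scale1r|exists true; rewrite scaleN1r].
have [nN|Nn] := ltnP n N.
  exists ((-1) ^+ b *: e s n); first exact: hNe.
  by exists 0; rewrite ?addr0 //; exact: gauge_le0.
exists 0 => //; exists ((-1) ^+ b *: e s n); rewrite ?add0r //=.
have := @gauge_leZ t ((-1) ^+ b) (d / 2) (e s n) (gauge_le_gen (hN _ Nn)).
by rewrite normrX normrN1 expr1n mul1r.
Qed.

(* A cell [p + (d / 2) U_t] either contains [0], and then lies in [d U_t], or
   stays away from [0] because it is closed. *)
Lemma U_small_gauge s t (d : R) : s < t -> 0 < d ->
  exists2 r : R, 0 < r & forall k, U_t x s k -> `|k| < r -> gauge_le t d k.
Proof.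
move=> st d0; have d2 : 0 < d / 2 by rewrite divr_gt0.
have [ps hps] := U_precompact st d2.
suff [r r0 hr] : exists2 r : R, 0 < r & forall p k, p \in ps ->
    gauge_le t (d / 2) (k - p) -> `|k| < r -> gauge_le t d k.
  by exists r => // k /hps[p pps kp]; exact: hr kp.
elim: ps {hps} => [|p ps [r r0 hr]]; first by exists 1.
have [zp|zp] := pselect (gauge_le t (d / 2) (0 - p)).
  exists r => // q k; rewrite inE => /orP[/eqP->|]; last exact: hr.
  move=> kp _; rewrite sub0r in zp.
  have := gauge_leD (ltW d2) (ltW d2) kp (gauge_leN zp).
  by rewrite opprK subrK -splitr.
have [r' r'0 hr'] : exists2 r' : R, 0 < r' &
    forall k, gauge_le t (d / 2) (k - p) -> ~ `|k| < r'.
  apply: contrapT => h; apply: zp; apply: gauge_le_closed => // r' r'0.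
  apply: contrapT => h'; apply: h; exists r' => // k kp kr'.
  apply: h'; exists (k - p) => //.
  by rewrite opprB addrA subrK sub0r normrN.
exists (Num.min r r'); first by rewrite lt_min r0.
move=> q k; rewrite inE lt_min => /orP[/eqP->|qps] kq /andP[kr kr'].
  by case: (hr' k).
exact: hr kq kr.
Qed.

End WillisBalls.

(** * Bounded measurable weights on the unit interval and their integrals *)

Section UnitIntervalIntegral.
Variable R : realType.
Notation mu := (@lebesgue_measure R).
Notation D01 := [set r : R | (0 < r < 1)%R].

(* No measurability is needed: the integral of a nonnegative function is a
   supremum over the simple functions below it. *)
Lemma ge0_le_integral_nomeas (d : measure_display) (T : measurableType d)
    (m : {measure set T -> \bar R}) (D : set T) (f g : T -> \bar R) :
  (forall r, D r -> (0 <= f r)%E) -> (forall r, D r -> (f r <= g r)%E) ->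
  (\int[m]_(r in D) f r <= \int[m]_(r in D) g r)%E.
Proof.
move=> f0 fg; have g0 r : D r -> (0 <= g r)%E.
  by move=> Dr; exact: le_trans (f0 _ Dr) (fg _ Dr).
rewrite !ge0_integralE //; apply: le_ereal_sup => _ [h hf <-].
exists h => // r; apply: le_trans (hf r) _; rewrite !patchE.
by case: ifPn => // /set_mem; exact: fg.
Qed.

Lemma D01E : D01 = `]0, 1[%classic.
Proof. by apply/seteqP; split=> r; rewrite /= in_itv. Qed.

Lemma measurable_D01 : measurable (D01 : set (measurableTypeR R)).
Proof. by rewrite D01E; exact: measurable_itv. Qed.
Hint Resolve measurable_D01 : core.

Lemma mu_D01 : mu D01 = 1%:E.
Proof. by rewrite D01E lebesgue_measure_itv /= lte_fin ltr01 oppr0 adde0. Qed.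

(** The multipliers against which step functions are integrated; [C] will bound the resulting
    operator. *)
Definition weight (g : R -> R) (C : R) : Prop :=
  measurable_fun (D01 : set (measurableTypeR R)) g /\ forall r, D01 r -> `|g r| <= C.

Lemma weight_integrable g C : weight g C -> mu.-integrable D01 (EFin \o g).
Proof.
move=> [mg gC].
have fin : (mu D01 < +oo)%E by rewrite mu_D01 ltry.
apply: measurable_bounded_integrable => //.
exists C; split; first exact: num_real.
by move=> M CM r Dr; apply: le_trans (gC _ Dr) (ltW CM).
Qed.

Definition ind (s t r : R) : R := \1_(`]s, t[%classic) r.

Lemma indE s t r : ind s t r = if (s < r) && (r < t) then 1 else 0.
Proof.
rewrite /ind indicE; case: ifPn => h.
  by rewrite mem_set //= in_itv.
by rewrite memNset //= in_itv; apply/negP.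
Qed.

Lemma weight_ind s t : weight (ind s t) 1.
Proof.
split.
  apply: measurable_funTS; exact: measurable_indic.
by move=> r _; rewrite indE; case: ifP; rewrite ?normr1 ?normr0.
Qed.

Lemma weightM g h C D : weight g C -> weight h D ->
  weight (fun r => g r * h r) (C * D).
Proof.
move=> [mg gC] [mh hD]; split; first exact: measurable_funM.
by move=> r Dr; rewrite normrM ler_pM // ?gC ?hD.
Qed.

Lemma weightZ g C a : weight g C -> weight (fun r => a * g r) (`|a| * C).
Proof.
move=> [mg gC]; split; first by apply: measurable_funM.
by move=> r Dr; rewrite normrM ler_wpM2l // gC.
Qed.

Lemma weightD g h C D : weight g C -> weight h D ->
  weight (fun r => g r + h r) (C + D).
Proof.
move=> [mg gC] [mh hD]; split; first exact: measurable_funD.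
by move=> r Dr; rewrite (le_trans (ler_normD _ _)) // lerD // ?gC ?hD.
Qed.

Lemma weight0 : weight (fun=> 0) 0.
Proof. by split=> // r _; rewrite normr0. Qed.

Definition moment (g : R -> R) (s t : R) : R :=
  \int[mu]_(r in D01) (g r * ind s t r).

Lemma Rintegral_ind s t : 0 <= s -> s < t -> t <= 1 ->
  \int[mu]_(r in D01) ind s t r = t - s.
Proof.
move=> s0 st t1; rewrite /Rintegral integral_indic //.
rewrite (_ : _ `&` _ = `]s, t[%classic); last first.
  apply/seteqP; split=> r /=; rewrite in_itv /=; first by case.
  move=> /andP[sr rt]; rewrite sr rt; split => //.
  by rewrite (le_lt_trans s0 sr) (lt_le_trans rt t1).
have h : mu `]s, t[%classic = (t - s)%:E.
  by rewrite lebesgue_measure_itv /= lte_fin st.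
exact: (congr1 fine h).
Qed.

Lemma moment_cst g a s t : 0 <= s -> s < t -> t <= 1 ->
  (forall r, s < r < t -> g r = a) -> moment g s t = a * (t - s).
Proof.
move=> s0 st t1 ga; rewrite -(Rintegral_ind s0 st t1) -RintegralZl //; last first.
  exact: weight_integrable (weight_ind _ _).
apply: eq_Rintegral => r _; rewrite indE; case: ifPn => [/ga ->//|].
by rewrite !mulr0.
Qed.

Lemma moment_lin g h C D a b s t : weight g C -> weight h D ->
  moment (fun r => a * g r + b * h r) s t = a * moment g s t + b * moment h s t.
Proof.
move=> wg wh; have wi := weight_ind s t.
have wgi := weight_integrable (weightM wg wi).
have whi := weight_integrable (weightM wh wi).
rewrite /moment -!RintegralZl // -RintegralD //.
- by apply: eq_Rintegral => r _; rewrite mulrDl !mulrA.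
- exact: weight_integrable (weightZ a (weightM wg wi)).
- exact: weight_integrable (weightZ b (weightM wh wi)).
Qed.

(** On [(0, 1)] the condition [trunc (1 / r) <= n] means [r > 1 / (n + 1)], so the level sets of the
    index are differences of intervals, and a preimage is a countable union of level sets. *)
Lemma weight_index (b : nat -> R) (C : R) : (forall n, `|b n| <= C) ->
  weight (fun r => b (Num.trunc r^-1)) C.
Proof.
move=> bC; split=> // _ B mB.
pose E n := D01 `&` [set r : R | n.+1%:R^-1 < r].
have mE n : measurable (E n : set (measurableTypeR R)).
  apply: measurableI => //.
  rewrite (_ : [set _ | _] = `]n.+1%:R^-1, +oo[%classic); first exact: measurable_itv.
  by apply/seteqP; split=> r; rewrite /= in_itv /= andbT.
have EP n r : D01 r -> E n r <-> (Num.trunc r^-1 <= n)%N.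
  move=> Dr; have /andP[r0 _] := Dr.
  rewrite truncn_le_nat; split=> [[_ /=]|h].
    by rewrite invf_plt ?posrE.
  by split=> //=; rewrite invf_plt ?posrE.
pose F n := if n is n'.+1 then E n `\` E n' else E n.
have mF n : measurable (F n : set (measurableTypeR R)).
  by case: n => [|n] //=; exact: measurableD.
have FP n r : D01 r -> F n r <-> Num.trunc r^-1 = n.
  move=> Dr; case: n => [|n] /=.
    by rewrite (EP _ _ Dr) leqn0; split=> [/eqP|->].
  split=> [[/(EP _ _ Dr) h1 h2]|h].
    apply/eqP; rewrite eqn_leq h1 ltnNge; apply/negP => h3.
    by apply: h2; apply/(EP _ _ Dr).
  by split; [apply/(EP _ _ Dr); rewrite h|move/(EP _ _ Dr); rewrite h ltnn].
rewrite (_ : _ `&` _ = \bigcup_(n in [set n | B (b n)]) (D01 `&` F n)).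
  by apply: bigcup_measurable => n _; exact: measurableI.
apply/seteqP; split=> r /=.
  move=> [Dr Br]; exists (Num.trunc r^-1) => //; split=> //.
  exact/(FP _ _ Dr).
by move=> [n /= Bn [Dr /(FP _ _ Dr) ->]].
Qed.

End UnitIntervalIntegral.

(** * Step functions, their weighted integrals and operators on the Willis space *)

Section WillisSpace.
Variables (R : realType) (X : completeNormedModType R) (x : nat -> X).
Variables (Z : completeNormedModType R) (J : (R -> X) -> Z).
Hypothesis x01 : forall n, 0 < `|x n| <= 1.
Hypothesis JZ : is_completion x J.
Notation mu := (@lebesgue_measure R).
Notation D01 := [set r : R | (0 < r < 1)%R].

(** Lists of triples [(s, t, y)] replace the indexed families of [Zcal], so that linear combinations
    become map and concatenation. *)
Definition steps (l : seq (R * R * X)) (r : R) : X :=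
  \sum_(p <- l) step_fun p.1.1 p.1.2 p.2 r.

Definition admissible (l : seq (R * R * X)) : Prop := forall p, p \in l ->
  0 < p.1.1 /\ p.1.1 < p.1.2 /\ p.1.2 < 1 /\ Y_t x p.1.1 p.2.

Lemma Zcal_steps l : admissible l -> Zcal x (steps l).
Proof.
move=> al; exists (size l), (fun i => (tnth (in_tuple l) i).1.1),
  (fun i => (tnth (in_tuple l) i).1.2), (fun i => (tnth (in_tuple l) i).2).
split; first by move=> i; apply: al; exact: mem_tnth.
by apply/funext => r; rewrite /steps big_tnth.
Qed.

Lemma Zcal_stepsP f : Zcal x f -> exists2 l, admissible l & f = steps l.
Proof.
move=> [n [s [t [y [h ->]]]]].
exists [seq (s i, t i, y i) | i <- enum 'I_n].
  by move=> p /mapP[i _ ->]; exact: h.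
by apply/funext => r; rewrite /steps big_map big_enum.
Qed.

Lemma step_funE s t (y : X) r : step_fun s t y r = ind s t r *: y.
Proof. by rewrite /step_fun indE; case: ifP; rewrite ?scale1r ?scale0r. Qed.

(** The vector integral of [g] times [steps l], as a finite sum over the representation [l]. That it
    depends only on the step function will follow from a norm bound. *)
Definition moments (g : R -> R) (l : seq (R * R * X)) : X :=
  \sum_(p <- l) moment g p.1.1 p.1.2 *: p.2.

Definition stepsZ (a : R) (l : seq (R * R * X)) :=
  [seq (p.1, a *: p.2) | p <- l].

Lemma admissible_lin a l m : admissible l -> admissible m ->
  admissible (stepsZ a l ++ m).
Proof.
move=> al am p; rewrite mem_cat => /orP[/mapP[q ql ->]|]; last exact: am.
have [s0 [st [t1 Yq]]] := al _ ql; do 3![split=> //].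
rewrite -[a *: _]addr0; apply: Y_lin => //.
by apply: U_Y => //; exact: U0.
Qed.

Lemma steps_lin a l m :
  steps (stepsZ a l ++ m) = (fun r => a *: steps l r + steps m r).
Proof.
apply/funext => r; rewrite /steps big_cat big_map /=; congr (_ + _).
rewrite scaler_sumr; apply: eq_bigr => p _.
by rewrite !step_funE scalerA mulrC -scalerA.
Qed.

Lemma moments_lin g a l m :
  moments g (stepsZ a l ++ m) = a *: moments g l + moments g m.
Proof.
rewrite /moments big_cat big_map /=; congr (_ + _).
by rewrite scaler_sumr; apply: eq_bigr => p _; rewrite !scalerA mulrC.
Qed.

(** Induction on the list; the weight bound is carried along to have integrability of the remaining
    sum. *)
Lemma functional_moments (xi : X -> R^o) g C l :
  (forall (a : R) u v, xi (a *: u + v) = a *: xi u + xi v) -> weight g C ->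
  (exists D, weight (fun r => g r * xi (steps l r)) D) /\
  xi (moments g l) = \int[mu]_(r in D01) (g r * xi (steps l r)).
Proof.
move=> linxi wg; elim: l => [|p l [[D wD] IH]].
  have h r : g r * xi (steps [::] r) = 0.
    by rewrite /steps big_nil (lin0 linxi) mulr0.
  split; first by exists 0; rewrite (_ : (fun r => _) = fun=> 0);
    [exact: weight0|apply/funext].
  rewrite /moments big_nil (lin0 linxi).
  under eq_Rintegral do rewrite h.
  by rewrite Rintegral_cst ?mul0r //; exact: measurable_D01.
have E r : g r * xi (steps (p :: l) r) =
    xi p.2 * (g r * ind p.1.1 p.1.2 r) + g r * xi (steps l r).
  rewrite /steps big_cons (linD linxi) step_funE (linZ linxi) mulrDr.
  by congr (_ + _); rewrite /GRing.scale /= mulrA mulrC.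
have w1 := weightM wg (weight_ind p.1.1 p.1.2).
split.
  exists (`|xi p.2| * (C * 1) + D).
  rewrite (_ : (fun r => _) = fun r => xi p.2 * (g r * ind p.1.1 p.1.2 r) +
    g r * xi (steps l r)); last exact/funext.
  exact: weightD (weightZ _ w1) wD.
under eq_Rintegral do rewrite E.
rewrite RintegralD; [|exact: measurable_D01|exact: weight_integrable (weightZ _ w1)
  |exact: weight_integrable wD].
rewrite RintegralZl; [|exact: measurable_D01|exact: weight_integrable w1].
by rewrite -IH /moments big_cons (linD linxi) (linZ linxi) /GRing.scale /= mulrC.
Qed.

Lemma norm_t_ge0 t y : (0 <= norm_t x t y)%E.
Proof. by apply: le_ereal_inf_tmp => _ [l [/ltW l0 _] <-]; rewrite lee_fin. Qed.

Lemma norm_t_le t l y : 0 < l -> gauge_le x t l y -> (norm_t x t y <= l%:E)%E.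
Proof. by move=> l0 ly; apply: ereal_inf_lbound; exists l. Qed.

Lemma norm_t0 t : norm_t x t 0 = 0%E.
Proof.
apply/eqP; rewrite eq_le norm_t_ge0 andbT; apply/lee_addgt0Pr => d d0.
by rewrite add0e; apply: norm_t_le => //; exact: gauge_le0.
Qed.

Lemma functional_le_norm_t (xi : X -> R^o) s t y :
  (forall (a : R) u v, xi (a *: u + v) = a *: xi u + xi v) ->
  (forall u, U_t x t u -> xi u <= 1) -> s <= t ->
  (`|xi y|%:E <= norm_t x s y)%E.
Proof.
move=> linxi xi1 st; apply: le_ereal_inf_tmp => _ [l [l0 [u [Uu ->]]] <-].
rewrite lee_fin (linZ linxi) normrM (gtr0_norm l0) ler_piMr ?(ltW l0) //.
have Uu' := U_mono x01 st Uu.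
rewrite ler_norml xi1 // andbT lerNl -(linN linxi).
by apply: xi1; exact: U_opp.
Qed.

(** Pointwise [|g xi(f)| <= |f(r)|_r]: for [r <= t] because [U_r] lies in [U_t], and for [r > t]
    because [g] vanishes there. *)
Lemma Znorm_ge_moments (xi : X -> R^o) g t l :
  (forall (a : R) u v, xi (a *: u + v) = a *: xi u + xi v) ->
  (forall u, U_t x t u -> xi u <= 1) ->
  weight g 1 -> (forall r, D01 r -> t < r -> g r = 0) ->
  (`|xi (moments g l)|%:E <= Znorm x (steps l))%E.
Proof.
move=> linxi xi1 wg gt.
have [[D wD] ->] := functional_moments l linxi wg.
rewrite EFin_normr_Rintegral;
  [|exact: measurable_D01|exact: weight_integrable wD].
apply: le_trans (le_abse_integral _ (@measurable_D01 R) _) _.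
  exact: measurable_int (weight_integrable wD).
apply: ge0_le_integral_nomeas => r Dr; first exact: abse_ge0.
have [rt|tr] := leP r t; last by rewrite gt // mul0r abse0 norm_t_ge0.
apply: le_trans (functional_le_norm_t (steps l r) linxi xi1 rt).
rewrite lee_fin normrM ler_piMl //.
by case: wg => _; apply.
Qed.

(** For [r] in [(s, t)] the gauge of index [r] is at most that of index [s], so the integrand is
    bounded by [l]. *)
Lemma Znorm_step s t l y : 0 < s -> s < t -> t < 1 -> 0 < l ->
  gauge_le x s l y -> (Znorm x (step_fun s t y) <= ((t - s) * l)%:E)%E.
Proof.
move=> s0 st t1 l0 ly.
have h : \int[mu]_(r in D01) (l * ind s t r) = l * (t - s).
  rewrite RintegralZl ?Rintegral_ind //; try exact: ltW.
  exact: measurable_D01.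
  exact: weight_integrable (weight_ind _ _).
have wi := weight_integrable (weightZ l (weight_ind s t)).
have fin : (\int[mu]_(r in D01) (l * ind s t r)%:E)%E = ((t - s) * l)%:E.
  rewrite mulrC -h /Rintegral fineK //.
  by apply: integrable_fin_num => //; exact: measurable_D01.
rewrite -fin; apply: ge0_le_integral_nomeas => r Dr; first exact: norm_t_ge0.
rewrite /step_fun indE; case: ifPn => [/andP[sr rt]|_].
  by rewrite mulr1; apply: norm_t_le => //; apply: gauge_le_mono ly => //; exact: ltW.
by rewrite norm_t0 mulr0.
Qed.

Lemma J_lin a l m : admissible l -> admissible m ->
  J (steps (stepsZ a l ++ m)) = a *: J (steps l) + J (steps m).
Proof.
have [+ _] := JZ; move=> Jlin al am; rewrite steps_lin.
by apply: Jlin; exact: Zcal_steps.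
Qed.

Lemma J_norm l : admissible l -> (`|J (steps l)|%:E = Znorm x (steps l)).
Proof. by move=> /Zcal_steps; have [_ [+ _]] := JZ; apply. Qed.

(* The integral [moments g l] of [g f] lies in [L U_t], since otherwise it is
   separated from [L U_t] by a functional [xi] with [|xi (f r)| <= |f r|_r]. *)
Lemma moments_gauge g C t l L : 0 <= C -> weight g C ->
  (forall r, D01 r -> t < r -> g r = 0) -> admissible l ->
  C * `|J (steps l)| < L -> gauge_le x t L (moments g l).
Proof.
move=> C0 wg gt al CL.
have L0 : 0 < L by apply: le_lt_trans CL; rewrite mulr_ge0.
wlog {C0} C0 : C wg CL / 0 < C => [wlg|].
  (* Enlarging [C] to [C + d] keeps the strict inequality, so that [g] may be divided by a positive
     constant. *)
  pose d := (L - C * `|J (steps l)|) / (`|J (steps l)| + 1).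
  have J1 : 0 < `|J (steps l)| + 1 by rewrite ltr_wpDl.
  have d0 : 0 < d by rewrite divr_gt0 // subr_gt0.
  apply: (wlg (C + d)); last by rewrite ltr_wpDl.
    by case: wg => mg gC; split=> // r /gC /le_trans; apply; rewrite lerDl ltW.
  rewrite mulrDl -ltrBrDl mulrC /d mulrA ltr_pdivrMr // mulrC.
  by rewrite ltr_pM2l ?subr_gt0 // ltrDl.
apply: contrapT => nU.
have [M [xi [linxi _ xi1 xiL]]] :=
  convex_separation (@U_closed _ _ x t) (U0 x t) (@U_convex _ _ x t) L0 nU.
have wg' : weight (fun r => C^-1 * g r) 1.
  have := weightZ C^-1 wg; rewrite gtr0_norm ?invr_gt0 // mulVf //.
  exact: lt0r_neq0.
have gt' r : D01 r -> t < r -> C^-1 * g r = 0.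
  by move=> Dr tr; rewrite gt // mulr0.
have := Znorm_ge_moments l linxi xi1 wg' gt'.
rewrite -J_norm // lee_fin.
have -> : moments (fun r => C^-1 * g r) l = C^-1 *: moments g l.
  rewrite /moments scaler_sumr; apply: eq_bigr => p _; rewrite scalerA.
  congr (_ *: _); have := moment_lin C^-1 0 p.1.1 p.1.2 wg wg.
  rewrite mul0r addr0 => <-; congr moment; apply/funext => r.
  by rewrite mul0r addr0.
rewrite (linZ linxi) normrM gtr0_norm ?invr_gt0 // ler_pdivrMl //.
by move: (ler_norm (xi (moments g l))); lra.
Qed.

(** The map sending [f] to the integral of [g f], extended from step functions to [Z] by density.
    The gauge estimate survives the limit because [L U_t] is closed. *)
Lemma weight_operator g C t : 0 <= C -> t <= 1 -> weight g C ->
  (forall r, D01 r -> t < r -> g r = 0) ->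
  exists S : Z -> X,
    [/\ forall (a : R) u v, S (a *: u + v) = a *: S u + S v,
        forall z L, C * `|z| < L -> gauge_le x t L (S z) &
        forall l, admissible l -> S (J (steps l)) = moments g l].
Proof.
move=> C0 t1 wg gt.
pose G : set (Z * X) := [set p | exists2 l, admissible l &
  p = (J (steps l), moments g l)].
have Glin a p q : G p -> G q -> G (a *: p.1 + q.1, a *: p.2 + q.2).
  move=> [l al ->] [m am ->]; exists (stepsZ a l ++ m).
    exact: admissible_lin.
  by rewrite J_lin // moments_lin.
have Gbnd p : G p -> `|p.2| <= C * `|p.1|.
  move=> [l al ->] /=; apply/ler_addgt0Pr => d d0.
  apply: (@gauge_le_norm _ _ x x01 t) => //.
    by apply: addr_ge0; [exact: mulr_ge0|exact: ltW].
  by apply: moments_gauge wg gt al _ => //; rewrite ltrDl.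
have Gdense z (d : R) : 0 < d -> exists2 p, G p & `|z - p.1| < d.
  move=> d0; have [_ [_ dense]] := JZ.
  have [f [/Zcal_stepsP[l al ->] zf]] := dense z d d0.
  by exists (J (steps l), moments g l) => //; exists l.
have [S linS SG] := dense_graph_extension C0 Glin Gbnd Gdense.
exists S; split=> //; last first.
  move=> l al; apply/eqP; rewrite -subr_eq0 -normr_le0.
  have Gl : G (J (steps l), moments g l) by exists l.
  by have := SG (J (steps l)) _ Gl; rewrite /= subrr normr0 mulr0.
move=> z L zL.
have L0 : 0 < L by apply: le_lt_trans zL; rewrite mulr_ge0.
apply: gauge_le_closed => // d d0.
(* The second bound keeps the approximant in the range [C |p.1| < L], where the gauge estimate is
   known. *)
pose d1 := Num.min d (L - C * `|z|).
have d10 : 0 < d1 by rewrite lt_min d0 subr_gt0.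
have C1 : 0 < C + 1 by rewrite ltr_wpDl.
have [p Gp] := Gdense z (d1 / (C + 1)) (divr_gt0 d10 C1).
rewrite ltr_pdivlMr // => zp.
have {}zp : C * `|z - p.1| < d1.
  by apply: le_lt_trans zp; rewrite mulrC ler_wpM2l // lerDl.
exists p.2; last first.
  by apply: le_lt_trans (SG z p Gp) (lt_le_trans zp _); rewrite ge_min lexx.
have CL : C * `|p.1| < L.
  have : `|p.1| <= `|z| + `|z - p.1|.
    by rewrite -{1}(subKr z p.1) ler_normB.
  move=> /(ler_wpM2l C0); rewrite mulrDr.
  have : d1 <= L - C * `|z| by rewrite ge_min lexx orbT.
  by move: zp; lra.
by case: Gp CL => l al -> /=; apply: moments_gauge.
Qed.

Definition lift_step (s t : R) (y : X) : Z := J (step_fun s t y).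

Lemma steps1 s t y : steps [:: (s, t, y)] = step_fun s t y.
Proof. by apply/funext => r; rewrite /steps big_seq1. Qed.

Lemma admissible1 s t y : 0 < s -> s < t -> t < 1 -> Y_t x s y ->
  admissible [:: (s, t, y)].
Proof. by move=> s0 st t1 Yy p; rewrite inE => /eqP->. Qed.

Lemma lift_step_lin s t a y z : 0 < s -> s < t -> t < 1 ->
  Y_t x s y -> Y_t x s z ->
  lift_step s t (a *: y + z) = a *: lift_step s t y + lift_step s t z.
Proof.
move=> s0 st t1 Yy Yz; rewrite /lift_step -!steps1 -J_lin; try exact: admissible1.
congr J; apply/funext => r.
by rewrite steps_lin !steps1 !step_funE scalerDr !scalerA mulrC.
Qed.

Lemma lift_step_norm s t l y : 0 < s -> s < t -> t < 1 -> 0 < l ->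
  gauge_le x s l y -> `|lift_step s t y| <= (t - s) * l.
Proof.
move=> s0 st t1 l0 ly; rewrite -lee_fin /lift_step -steps1 J_norm.
  by rewrite steps1; exact: Znorm_step.
by apply: admissible1 => //; apply/Y_gauge => //; exists l.
Qed.

End WillisSpace.

(** * Operator norms and approximable operators *)

Section OperatorNorm.
Variables (R : realType) (V W : normedModType R).
Implicit Type T : V -> W.

Lemma opnorm_ge T v : bounded_linear T -> `|v| <= 1 -> `|T v| <= opnorm T.
Proof.
move=> [_ [M TM]] v1; apply: ub_le_sup; last by exists v.
exists `|M| => _ [u /= u1 <-]; apply: le_trans (TM u) _.
apply: (@le_trans _ _ (`|M| * `|u|)); first by rewrite ler_wpM2r // ler_norm.
by rewrite ler_piMr.
Qed.

Lemma opnorm_le T (M : R) :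
  (forall v, `|v| <= 1 -> `|T v| <= M) -> opnorm T <= M.
Proof.
move=> TM; apply: ge_sup; last by move=> _ [v /= v1 <-]; exact: TM.
by exists `|T 0|; exists 0 => //=; rewrite normr0.
Qed.

Lemma opnorm_ge0 T : bounded_linear T -> 0 <= opnorm T.
Proof. by move=> bT; apply: le_trans (opnorm_ge bT (v := 0) _); rewrite ?normr0. Qed.

Lemma bounded_linearB T S : bounded_linear T -> bounded_linear S ->
  bounded_linear (fun v => T v - S v).
Proof.
move=> [linT [M TM]] [linS [N SN]]; split.
  by move=> a u v; rewrite linT linS opprD addrACA scalerBr.
exists (M + N) => v; rewrite (le_trans (ler_normB _ _)) // mulrDl.
exact: lerD.
Qed.

Lemma finite_rank0 : finite_rank (fun _ : V => 0 : W).
Proof.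
split; last by exists 0, (fun=> 0) => v; exists (fun=> 0); rewrite big_ord0.
split; first by move=> a u v; rewrite scaler0 addr0.
by exists 0 => v; rewrite normr0 mul0r.
Qed.

Lemma approximable0 : approximable (fun _ : V => 0 : W).
Proof.
split; first by case: finite_rank0.
move=> d d0; exists (fun=> 0); split; first exact: finite_rank0.
by apply: opnorm_le => v _; rewrite subr0 normr0 ltW.
Qed.

End OperatorNorm.

(** * Null sequences and their supremum norm *)

Lemma c0_bounded (R : realType) (a : nat -> R) : c0 a ->
  has_ubound (range (fun n => `|a n|)).
Proof.
move=> ca; have [N _ hN] := (@cvgrPdist_lt R R _ _ _ _ _).1 ca _ ltr01.
exists (1 + \sum_(i < N) `|a i|) => _ [n _ <-].
have [nN|Nn] := ltnP n N.
  rewrite (bigD1 (Ordinal nN)) //= addrCA lerDl addr_ge0 //.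
  exact: sumr_ge0.
have := hN n Nn; rewrite /= sub0r normrN => /ltW h.
by rewrite (le_trans h) // lerDl sumr_ge0.
Qed.

Lemma le_supnorm (R : realType) (a : nat -> R) n : c0 a -> `|a n| <= supnorm a.
Proof. by move=> /c0_bounded ua; apply: ub_le_sup => //; exists n. Qed.

Lemma supnorm_ge0 (R : realType) (a : nat -> R) : c0 a -> 0 <= supnorm a.
Proof. by move=> ca; apply: le_trans (le_supnorm 0 ca). Qed.

Lemma c0_lin (R : realType) (a b : nat -> R) (al be : R) : c0 a -> c0 b ->
  c0 (fun n => al * a n + be * b n).
Proof.
move=> ca cb; rewrite /c0 (_ : 0 = al * 0 + be * 0); last by rewrite !mulr0 addr0.
by apply: cvgD; apply: cvgMr.
Qed.

(** * Functionals on [K] and the weights attached to null sequences *)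

Section Embedding.
Variables (R : realType) (X : completeNormedModType R) (x : nat -> X).
Variables (Z : completeNormedModType R) (J : (R -> X) -> Z).
Hypothesis x01 : forall n, 0 < `|x n| <= 1.
Hypothesis x_cvg0 : (fun n => `|x n|) @ \oo --> (0 : R).
Hypothesis JZ : is_completion x J.
Notation D01 := [set r : R | (0 < r < 1)%R].

(** Reading [K] as the set of exponent [0] makes the comparison of [U_s] with [U_t] available at
    [s = 0]. *)
Lemma K_setE : K_set x = U_t x 0.
Proof.
rewrite /K_set /U_t; congr (closure (conv_hull _)).
by apply/seteqP; split=> y [n]; rewrite ?powRr0 ?invr1 ?scale1r => ny;
  exists n; rewrite ?powRr0 ?invr1 ?scale1r.
Qed.

(* [phi] is only continuous for the gauge of [U_u]; on [U_0], which is
   precompact for that gauge, it is nevertheless a uniform limit of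
   functionals that are continuous on [X]. *)
Lemma functional_approximation (Phi : Z -> R^o) (u v eps : R) :
  bounded_linear Phi -> 0 < u -> u < v -> v < 1 -> 0 < eps ->
  exists xi : X -> R^o, bounded_linear xi /\
    forall k, U_t x 0 k -> `|xi k - Phi (lift_step J u v k)| <= eps.
Proof.
move=> [linPhi [M PhiM]] u0 uv v1 eps0.
pose phi k := Phi (lift_step J u v k).
have linphi (a : R) y z : Y_t x u y -> Y_t x u z ->
    phi (a *: y + z) = a *: phi y + phi z.
  by move=> Yy Yz; rewrite /phi (lift_step_lin JZ) // linPhi.
have U0Y k : U_t x 0 k -> Y_t x u k.
  by move=> Uk; apply: (Y_mono x01 (ltW u0)); exact: U_Y.
have Y0 : Y_t x u 0 by apply: U0Y; exact: U0.
have phi0 : phi 0 = 0.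
  by have := linphi (-1) 0 0 Y0 Y0; rewrite scaler0 addr0 scaleN1r addNr.
have phiZ a y : Y_t x u y -> phi (a *: y) = a * phi y.
  by move=> Yy; have := linphi a y 0 Yy Y0; rewrite !addr0 phi0 addr0.
pose B := `|M| + 1.
have B0 : 0 < B by rewrite ltr_wpDl.
have phiB l y : 0 < l -> gauge_le x u l y -> `|phi y| <= B * l.
  move=> l0 ly; apply: le_trans (PhiM _) _.
  have h : `|lift_step J u v y| <= l.
    apply: le_trans (lift_step_norm x01 JZ u0 uv v1 l0 ly) _.
    by rewrite ler_piMl ?(ltW l0) //; lra.
  apply: (@le_trans _ _ (B * `|lift_step J u v y|)).
    by rewrite ler_wpM2r // /B (le_trans (ler_norm M)) // lerDl.
  by rewrite ler_wpM2l // ltW.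
(* On [U_0] a norm below [r] forces a gauge of at most [eps / B], hence [|phi k| <= eps]; otherwise
   [|k| >= r] and [|phi k| <= B <= (B / r) |k|]. *)
have [r r0 hr] := U_small_gauge x01 x_cvg0 u0 (divr_gt0 eps0 B0).
have phi_le k : U_t x 0 k -> `|phi k| <= eps + B / r * `|k|.
  move=> Uk; have [kr|rk] := ltP `|k| r.
    have := phiB _ _ (divr_gt0 eps0 B0) (hr _ Uk kr).
    rewrite mulrC divfK ?lt0r_neq0 // => h; apply: le_trans h _.
    by rewrite lerDl mulr_ge0 // divr_ge0 // ltW.
  have ku : gauge_le x u 1 k.
    by apply: (gauge_le_mono x01 (ltW u0)); exact: gauge_leU.
  have := phiB _ _ ltr01 ku; rewrite mulr1 => h; apply: le_trans h _.
  rewrite -[leLHS]add0r lerD ?(ltW eps0) // mulrAC ler_pdivlMr //.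
  by rewrite ler_wpM2l // ltW.
(* The pairs [(k, phi k + eps)] impose [xi <= phi + eps] on [U_0]; the symmetry of [U_0] turns this
   into a two-sided estimate. *)
pose G : set (X * R) := [set p | exists l k,
  [/\ 0 <= l, U_t x 0 k & p = (l *: k, l * phi k + eps * l)]].
have coneG : cone G.
  split.
    move=> _ _ [l [k [l0 Uk ->]]] [m [k' [m0 Uk' ->]]] /=.
    have [w Uw wE] := convex_addZ (@U_convex _ _ x 0) l0 m0 Uk Uk'.
    exists (l + m), w; split=> //; first exact: addr_ge0.
    congr pair => //; have := congr1 phi wE.
    have Ymk : Y_t x u (m *: k').
      by rewrite -[m *: k']addr0; apply: Y_lin => //; exact: U0Y.
    rewrite linphi ?phiZ //; try exact: U0Y.
    by rewrite /GRing.scale /= => <-; ring.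
  move=> t _ t0 [l [k [l0 Uk ->]]] /=.
  exists (t * l), k; split=> //; first exact: mulr_ge0.
  by rewrite scalerA; congr pair; ring.
have Br : 0 <= B / r by rewrite divr_ge0 // ltW.
have [||xi [linxi xiM xiG]] := hahn_banach_norm coneG Br.
- by exists (0 *: 0, 0 * phi 0 + eps * 0), 0, 0; split=> //; exact: U0.
- move=> _ _ [l [k [l0 Uk [-> ->]]]]; rewrite normrZ (ger0_norm l0).
  have -> : l * phi k + eps * l + B / r * (l * `|k|) =
    l * (phi k + (eps + B / r * `|k|)) by ring.
  rewrite mulr_ge0 // -lerBlDl sub0r (le_trans _ (phi_le _ Uk)) //.
  by rewrite -normrN ler_norm.
have xi_le k : U_t x 0 k -> xi k <= phi k + eps.
  by move=> Uk; apply: xiG; exists 1, k; rewrite scale1r mul1r mulr1.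
exists xi; split; first by split=> //; exists (B / r).
move=> k Uk; rewrite ler_norml; apply/andP; split; last first.
  by have := xi_le _ Uk; rewrite /phi; lra.
have phiN : phi (- k) = - phi k.
  by rewrite -scaleN1r phiZ ?mulN1r //; exact: U0Y.
have := xi_le _ (U_opp Uk); rewrite (linN linxi) phiN.
by rewrite /phi; lra.
Qed.

(** The function [g_a]: [trunc (1 / r) = n + 4] exactly when [1 / (n + 5) < r <= 1 / (n + 4)], and
    the shift by [4] confines the support to [(0, 1/4]]. *)
Definition index_weight (a : nat -> R) (r : R) : R :=
  let m := Num.trunc r^-1 in if (4 <= m)%N then a (m - 4)%N else 0.

Lemma weight_index_weight a : c0 a -> weight (index_weight a) (supnorm a).
Proof.
move=> ca; apply: (@weight_index R (fun m => if (4 <= m)%N then a (m - 4)%N else 0)).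
by move=> m; case: ifP => _; rewrite ?normr0; [exact: le_supnorm|exact: supnorm_ge0].
Qed.

Lemma index_weight0 a r : D01 r -> 4^-1 < r -> index_weight a r = 0.
Proof.
move=> /andP[r0 _] r4; rewrite /index_weight ifF //; apply/negbTE.
by rewrite -ltnNge ltnS truncn_le_nat invf_plt ?posrE.
Qed.

Lemma index_weight_lin a b al be r :
  index_weight (fun n => al * a n + be * b n) r =
  al * index_weight a r + be * index_weight b r.
Proof. by rewrite /index_weight; case: ifP; rewrite // !mulr0 addr0. Qed.

Lemma index_weight_itv a n r : (n + 5)%:R^-1 < r < (n + 4)%:R^-1 ->
  index_weight a r = a n.
Proof.
move=> /andP[r1 r2].
have n4 : 0 < (n + 4)%:R :> R by rewrite ltr0n addn_gt0 orbT.
have n5 : 0 < (n + 5)%:R :> R by rewrite ltr0n addn_gt0 orbT.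
have r0 : 0 < r by apply: lt_trans r1; rewrite invr_gt0.
have E : Num.trunc r^-1 = (n + 4)%N.
  apply: truncn_def; rewrite -addnS; apply/andP; split.
    by rewrite ltW // invf_pgt ?posrE.
  by rewrite invf_plt ?posrE.
by rewrite /index_weight E leq_addl addnK.
Qed.

Lemma embedding_operators : exists S : (nat -> R) -> Z -> X, forall a, c0 a ->
  [/\ forall (t : R) u v, S a (t *: u + v) = t *: S a u + S a v,
      forall z L, supnorm a * `|z| < L -> gauge_le x 4^-1 L (S a z) &
      forall l, admissible x l -> S a (J (steps l)) = moments (index_weight a) l].
Proof.
suff ex (a : nat -> R) : exists S : Z -> X, c0 a ->
  [/\ forall (t : R) u v, S (t *: u + v) = t *: S u + S v,
      forall z L, supnorm a * `|z| < L -> gauge_le x 4^-1 L (S z) &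
      forall l, admissible x l -> S (J (steps l)) = moments (index_weight a) l].
  by have [S SP] := choice ex; exists S.
(* Outside [c0] the claim is vacuous; the zero map serves as a default so that [choice] applies to
   all sequences. *)
have [ca|nca] := pselect (c0 a); last by exists (fun=> 0).
have t1 : 4^-1 <= 1 :> R by lra.
have [S SP] := weight_operator x01 JZ (supnorm_ge0 ca) t1
  (weight_index_weight ca) (@index_weight0 a).
by exists S.
Qed.

End Embedding.

(** * The operators [psi a]: compactness, linearity in [a] and norm estimates *)

Section EmbeddingBounds.
Variables (R : realType) (X : completeNormedModType R) (x : nat -> X).
Variables (Z : completeNormedModType R) (J : (R -> X) -> Z).
Hypothesis x01 : forall n, 0 < `|x n| <= 1.
Hypothesis x_cvg0 : (fun n => `|x n|) @ \oo --> (0 : R).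
Hypothesis JZ : is_completion x J.
Variable S : (nat -> R) -> Z -> X.
Hypothesis SP : forall a, c0 a ->
  [/\ forall (t : R) u v, S a (t *: u + v) = t *: S a u + S a v,
      forall z L, supnorm a * `|z| < L -> gauge_le x 4^-1 L (S a z) &
      forall l, admissible x l -> S a (J (steps l)) = moments (index_weight a) l].

(** The factor [4] is the inverse of the length of [(1/2, 3/4)]; with it the second factor is a
    contraction from the gauge of [U_(1/2)] into [Z]. *)
Definition psi (a : nat -> R) (z : Z) : Z :=
  4 *: lift_step J 2^-1 (3 / 4) (S a z).

Let itv : [/\ 0 < 2^-1 :> R, 2^-1 < 3 / 4 :> R & 3 / 4 < 1 :> R].
Proof. by split; lra. Qed.

Let S_Y a z : c0 a -> Y_t x 2^-1 (S a z).
Proof.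
move=> ca; have [_ Sg _] := SP ca.
apply: (@Y_mono _ _ _ x01 4^-1); first lra.
apply/Y_gauge; exists (supnorm a * `|z| + 1).
  by rewrite ltr_wpDl // mulr_ge0 // supnorm_ge0.
by apply: Sg; rewrite ltrDl.
Qed.

Let S_norm a z : c0 a -> `|S a z| <= supnorm a * `|z|.
Proof.
move=> ca; have [_ Sg _] := SP ca.
apply/ler_addgt0Pr => d d0.
apply: (@gauge_le_norm _ _ _ x01 4^-1); first lra.
  by rewrite addr_ge0 ?(ltW d0) // mulr_ge0 // supnorm_ge0.
by apply: Sg; rewrite ltrDl.
Qed.

Lemma psi_le a z (L : R) : 0 < L -> gauge_le x 2^-1 L (S a z) -> `|psi a z| <= L.
Proof.
move=> L0 SL; have [s0 st t1] := itv.
have := lift_step_norm x01 JZ s0 st t1 L0 SL.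
by rewrite /psi normrZ gtr0_norm //; lra.
Qed.

Lemma psi_linear a : c0 a ->
  forall (t : R) u v, psi a (t *: u + v) = t *: psi a u + psi a v.
Proof.
move=> ca t u v; have [linS _ _] := SP ca; have [s0 st t1] := itv.
rewrite /psi linS (lift_step_lin JZ) //; try exact: S_Y.
by rewrite scalerDr !scalerA mulrC.
Qed.

Lemma psi_norm a z : c0 a -> `|psi a z| <= supnorm a * `|z|.
Proof.
move=> ca; have [_ Sg _] := SP ca.
apply/ler_addgt0Pr => d d0; apply: psi_le.
  by rewrite ltr_wpDl // mulr_ge0 // supnorm_ge0.
apply: (@gauge_le_mono _ _ _ x01 4^-1); first lra.
by apply: Sg; rewrite ltrDl.
Qed.

Lemma psi_bounded a : c0 a -> bounded_linear (psi a).
Proof.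
move=> ca; split; first exact: psi_linear.
by exists (supnorm a) => z; exact: psi_norm.
Qed.

(** [S a] sends the unit ball into a multiple of [U_(1/4)], which is totally bounded for the gauge
    of [U_(1/2)], and that gauge dominates the norm of the image in [Z]. *)
Lemma psi_compact a : c0 a -> compact_op (psi a).
Proof.
move=> ca; split; first exact: psi_bounded.
have [linS Sg _] := SP ca.
have linpsi := psi_linear ca.
(* The added [1] makes [supnorm a * |z| < C] strict on the unit ball. *)
pose C := supnorm a + 1.
have C0 : 0 < C by rewrite ltr_wpDl // supnorm_ge0.
apply: totally_bounded_precompact => d d0.
have h42 : 4^-1 < 2^-1 :> R by lra.
have d1 : 0 < d / (2 * C) by rewrite divr_gt0 // mulr_gt0.
have [ps hps] := U_precompact x01 x_cvg0 h42 d1.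
(* For two points of one cell the vectors [u] differ by gauge at most [d / C], hence the values of
   [S a] by at most [d]. *)
pose B i := [set psi a z | z in [set z | exists2 u, S a z = C *: u &
  gauge_le x 2^-1 (d / (2 * C)) (u - nth 0 ps i)]].
exists (size ps), B; split.
  move=> _ [z /= z1 <-].
  have [|u [Uu Su]] := Sg z C.
    apply: (@le_lt_trans _ _ (supnorm a)); last by rewrite ltrDl.
    by rewrite ler_piMr // supnorm_ge0.
  have [p pps up] := hps _ Uu.
  exists (index p ps); first by rewrite index_mem.
  by exists z => //; exists u => //; rewrite nth_index.
move=> i _ _ [z [u Su ui] <-] [z' [u' Su' u'i] <-].
rewrite -(linB linpsi); apply: psi_le => //.
rewrite (linB linS) Su Su' -scalerBr.
have := gauge_leD (ltW d1) (ltW d1) ui (gauge_leN u'i).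
rewrite opprB addrA subrK => /(@gauge_leZ _ _ _ _ C).
rewrite (gtr0_norm C0) (_ : C * _ = d) //; field.
exact: lt0r_neq0.
Qed.

(** The operators [S a] are chosen separately for each sequence, so linearity in [a] is recovered by
    density: the defect [T] is bounded and vanishes on step functions, where moments are linear in
    the weight. *)
Lemma psi_additive a b (al be : R) : c0 a -> c0 b ->
  forall z, psi (fun n => al * a n + be * b n) z = al *: psi a z + be *: psi b z.
Proof.
move=> ca cb z; have cab := c0_lin al be ca cb; have [s0 st t1] := itv.
have [linS _ SJ] := SP cab; have [linSa _ SaJ] := SP ca; have [linSb _ SbJ] := SP cb.
set ab := fun n => _ in cab linS SJ *.
suff -> : psi ab z = 4 *: lift_step J 2^-1 (3 / 4) (al *: S a z + be *: S b z).
  have Y0 : Y_t x 2^-1 0 by apply: U_Y; exact: U0.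
  have Yb : Y_t x 2^-1 (be *: S b z).
    by rewrite -[be *: _]addr0; apply: Y_lin => //; exact: S_Y.
  have lift0 : lift_step J 2^-1 (3 / 4) 0 = 0.
    have := lift_step_lin JZ (-1) s0 st t1 Y0 Y0.
    by rewrite scaler0 addr0 scaleN1r addNr.
  have liftb : lift_step J 2^-1 (3 / 4) (be *: S b z) =
      be *: lift_step J 2^-1 (3 / 4) (S b z).
    rewrite -[X in lift_step _ _ _ X]addr0 (lift_step_lin JZ) //; last exact: S_Y.
    by rewrite lift0 addr0.
  rewrite (lift_step_lin JZ) //; last exact: S_Y.
  by rewrite liftb scalerDr /psi !scalerA ![4 * _]mulrC.
congr (_ *: lift_step _ _ _ _); apply/eqP; rewrite -subr_eq0 -normr_le0.
pose T z := S ab z - (al *: S a z + be *: S b z).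
have linT (t : R) u v : T (t *: u + v) = t *: T u + T v.
  have E : al *: S a (t *: u + v) + be *: S b (t *: u + v) =
      t *: (al *: S a u + be *: S b u) + (al *: S a v + be *: S b v).
    by rewrite linSa linSb !scalerDr !scalerA (mulrC t al) (mulrC t be) addrACA.
  by rewrite /T linS E scalerBr opprD addrACA.
pose N := supnorm ab + (`|al| * supnorm a + `|be| * supnorm b).
have N0 : 0 <= N by rewrite !addr_ge0 ?mulr_ge0 ?supnorm_ge0.
have TN u : `|T u| <= N * `|u|.
  rewrite (le_trans (ler_normB _ _)) // /N mulrDl lerD ?S_norm //.
  rewrite (le_trans (ler_normD _ _)) // mulrDl !normrZ -!mulrA.
  by apply: lerD; rewrite ler_wpM2l // S_norm.
have TJ l : admissible x l -> T (J (steps l)) = 0.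
  move=> al'; rewrite /T SJ // SaJ // SbJ // /moments !scaler_sumr -big_split /=.
  rewrite -sumrB big1 // => p _.
  rewrite (_ : index_weight ab = fun r => al * index_weight a r + be * index_weight b r).
    rewrite (moment_lin _ _ _ _ (weight_index_weight ca) (weight_index_weight cb)).
    by rewrite scalerDl !scalerA subrr.
  by apply/funext => r; rewrite index_weight_lin.
rewrite -/(T z); apply/ler_addgt0Pr => d d0; rewrite add0r.
have N1 : 0 < N + 1 by rewrite ltr_wpDl.
have [_ [_ dense]] := JZ.
have [f [/Zcal_stepsP[l al' ->]]] := dense z (d / (N + 1)) (divr_gt0 d0 N1).
rewrite ltr_pdivlMr // => zl.
have -> : T z = T (z - J (steps l)) by rewrite (linB linT) TJ // subr0.
apply: le_trans (TN _) (le_trans _ (ltW zl)).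
by rewrite mulrC ler_wpM2l // lerDl.
Qed.

Lemma psi_qnorm_le a : c0 a -> qnorm (psi a) <= supnorm a.
Proof.
move=> ca; apply: (@le_trans _ _ (opnorm (fun z => psi a z - 0))).
  apply: ge_inf; last by exists (fun=> 0) => //; exact: approximable0.
  exists 0 => _ [T [bT _] <-]; apply: opnorm_ge0.
  by apply: bounded_linearB => //; exact: psi_bounded.
apply: opnorm_le => z z1; rewrite subr0; apply: le_trans (psi_norm _ ca) _.
by rewrite ler_piMr // supnorm_ge0.
Qed.

(** Integration over [(1/2, 3/4)] undoes the second factor of [psi] and, being a contraction, moves
    estimates from [Z] to [X]. *)
Lemma step_average_operator : exists Q : Z -> X,
  [/\ forall (t : R) u v, Q (t *: u + v) = t *: Q u + Q v,
      forall z, `|Q z| <= `|z| &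
      forall y, Y_t x 2^-1 y -> Q (4 *: lift_step J 2^-1 (3 / 4) y) = y].
Proof.
have [s0 st t1] := itv.
have [|Q [linQ Qg QJ]] := weight_operator x01 JZ ler01 (ltW t1)
  (weight_ind 2^-1 (3 / 4)).
  move=> r _ tr; rewrite indE ifF //; apply/negbTE.
  by rewrite negb_and -[X in _ || X]leNgt (ltW tr) orbT.
exists Q; split=> //.
  move=> z; apply/ler_addgt0Pr => d d0.
  apply: (@gauge_le_norm _ _ _ x01 (3 / 4)); [exact: ltW| |].
    by rewrite addr_ge0 // ltW.
  by apply: Qg; rewrite mul1r ltrDl.
move=> y Yy; rewrite (linZ linQ) /lift_step -steps1 QJ; last exact: admissible1.
rewrite /moments big_seq1 /= (@moment_cst _ _ 1); try exact: ltW.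
- by rewrite scalerA (_ : 4 * _ = 1) ?scale1r //; lra.
- exact: st.
- by move=> r h; rewrite indE h.
Qed.

(** Applying [Q] to [(psi a - T) (zk k)] gives [a_n k] minus a finite rank expression; once its
    coefficients are approximated by functionals continuous on [X], division by [a_n] yields a
    competitor [V] in the hypothesis on [K]. *)
Lemma psi_finite_rank_dist a n c T : c0 a ->
  (forall V : X -> X, finite_rank V ->
     (c%:E <= ereal_sup [set (`|y - V y|)%:E | y in K_set x])%E) ->
  finite_rank T -> c * `|a n| <= opnorm (fun z => psi a z - T z).
Proof.
move=> ca hc frT; have [linS _ SJ] := SP ca; have [bT _] := frT.
have bD := bounded_linearB (psi_bounded ca) bT.
set q := opnorm _.
have q0 : 0 <= q by exact: opnorm_ge0.
have [->|an0] := eqVneq (a n) 0; first by rewrite normr0 mulr0.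
have [Q [linQ Qle QE]] := step_average_operator.
have [m [phi [w [bphi TE]]]] := finite_rank_coordinates frT.
(* On [(u, v)] the weight of [a] is constantly [a n]. *)
pose u : R := (n + 5)%:R^-1; pose v : R := (n + 4)%:R^-1.
have u0 : 0 < u by rewrite invr_gt0 ltr0n addn_gt0 orbT.
have uv : u < v by rewrite ltf_pV2 ?posrE ?ltr0n ?addn_gt0 ?orbT // ltr_nat ltn_add2l.
have v1 : v < 1 by rewrite invf_lt1 ?ltr0n ?addn_gt0 ?orbT // ltr1n !addnS.
have vu : 0 < v - u by rewrite subr_gt0.
pose zk k := (v - u)^-1 *: lift_step J u v k.
have U0Y k : U_t x 0 k -> Y_t x u k.
  by move=> Uk; apply: (Y_mono x01 (ltW u0)); exact: U_Y.
have zk1 k : U_t x 0 k -> `|zk k| <= 1.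
  move=> Uk; have ku : gauge_le x u 1 k.
    by apply: (gauge_le_mono x01 (ltW u0)); exact: gauge_leU.
  have := lift_step_norm x01 JZ u0 uv v1 ltr01 ku.
  by rewrite mulr1 normrZ gtr0_norm ?invr_gt0 // ler_pdivrMl // mulr1.
have Sz k : U_t x 0 k -> S a (zk k) = a n *: k.
  move=> Uk; rewrite (linZ linS) /lift_step -steps1 SJ; last first.
    by apply: admissible1 => //; exact: U0Y.
  rewrite /moments big_seq1 /= (@moment_cst _ _ (a n)); try exact: ltW.
  - by rewrite scalerA mulrC mulfK // lt0r_neq0.
  - exact: uv.
  - by move=> r; exact: index_weight_itv.
have an_gt0 : 0 < `|a n| by rewrite normr_gt0.
rewrite -ler_pdivlMr //.
(* Changing each coefficient by at most [eps] costs at most [eps * Wn], which disappears as [eps]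
   tends to [0]. *)
pose Wn := \sum_(i < m) `|Q (w i)|.
have Wn0 : 0 <= Wn by exact: sumr_ge0.
suff main (eps : R) : 0 < eps -> c <= (q + eps * Wn) / `|a n|.
  apply/ler_addgt0Pr => d d0.
  (* This value of [eps] makes the error at most [d], also when [Wn] vanishes. *)
  have e0 : 0 < d * `|a n| / (Wn + 1).
    by rewrite divr_gt0 ?mulr_gt0 // ltr_wpDl.
  apply: le_trans (main _ e0) _.
  have W1 : 0 < Wn + 1 by rewrite ltr_wpDl.
  have h : d * `|a n| / (Wn + 1) * Wn <= d * `|a n|.
    rewrite mulrAC ler_pdivrMr //.
    by apply: ler_wpM2l; [rewrite mulr_ge0 // ltW|rewrite lerDl].
  by rewrite mulrDl; apply: lerD => //; rewrite ler_pdivrMr.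
move=> eps0.
(* The tolerance is scaled by [v - u] to compensate for the normalization of [zk]. *)
have veps : 0 < eps * (v - u) by exact: mulr_gt0.
have [xi xiP] := choice (fun i =>
  functional_approximation x01 x_cvg0 JZ (bphi i) u0 uv v1 veps).
pose xi' i y := (v - u)^-1 * xi i y.
have xi'P i k : U_t x 0 k -> `|xi' i k - phi i (zk k)| <= eps.
  move=> Uk; have [_ h] := xiP i; have [linphi _] := bphi i.
  rewrite (linZ linphi) /GRing.scale /= -mulrBr normrM gtr0_norm ?invr_gt0 //.
  by rewrite ler_pdivrMl // mulrC; exact: h.
pose V y := (a n)^-1 *: \sum_(i < m) xi' i y *: Q (w i).
have frV : finite_rank V.
  have [Mx MxP] := choice (fun i => (xiP i).1.2).
  split; last first.
    exists m, (fun i => Q (w i)) => y; exists (fun i => (a n)^-1 * xi' i y).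
    by rewrite /V scaler_sumr; apply: eq_bigr => i _; rewrite scalerA.
  split.
    move=> t y y'; rewrite /V.
    have -> : \sum_(i < m) xi' i (t *: y + y') *: Q (w i) =
        t *: \sum_(i < m) xi' i y *: Q (w i) + \sum_(i < m) xi' i y' *: Q (w i).
      rewrite scaler_sumr -big_split; apply: eq_bigr => i _ /=.
      have [[linxi _] _] := xiP i; rewrite /xi' linxi scalerA -scalerDl.
      by congr (_ *: _); rewrite /GRing.scale /=; ring.
    by rewrite scalerDr !scalerA mulrC.
  exists (`|a n|^-1 * \sum_(i < m) ((v - u)^-1 * Mx i * `|Q (w i)|)) => y.
  rewrite /V normrZ normfV -mulrA ler_wpM2l ?invr_ge0 // mulr_suml.
  apply: le_trans (ler_norm_sum _ _ _) _; apply: ler_sum => i _.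
  rewrite normrZ /xi' normrM gtr0_norm ?invr_gt0 // -!mulrA ler_pM2l ?invr_gt0 //.
  by rewrite [`|Q _| * _]mulrC mulrA ler_wpM2r //; exact: MxP.
rewrite -lee_fin; apply: le_trans (hc V frV) _.
apply: ge_ereal_sup => _ [k Kk <-]; rewrite lee_fin ler_pdivlMr //.
rewrite K_setE in Kk.
rewrite mulrC -normrZ scalerBr /V scalerA mulfV // scale1r.
have E1 : a n *: k - \sum_(i < m) phi i (zk k) *: Q (w i) = Q (psi a (zk k) - T (zk k)).
  rewrite (linB linQ) /psi Sz // QE; last first.
    by rewrite -Sz //; exact: S_Y.
  rewrite TE (lin_sum linQ); congr (_ - _); apply: eq_bigr => i _.
  by rewrite (linZ linQ).
(* The first term is bounded by [q] since [Q] is a contraction and [zk k] lies in the unit ball; the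
   second is the coefficient error. *)
have -> : a n *: k - \sum_(i < m) xi' i k *: Q (w i) =
    Q (psi a (zk k) - T (zk k)) - \sum_(i < m) (xi' i k - phi i (zk k)) *: Q (w i).
  rewrite -E1; under [X in _ = _ - X]eq_bigr do rewrite scalerBl.
  by rewrite sumrB opprB addrA subrK.
rewrite (le_trans (ler_normB _ _)) // lerD //.
  by apply: le_trans (Qle _) _; apply: (opnorm_ge bD); exact: zk1.
apply: le_trans (ler_norm_sum _ _ _) _; rewrite /Wn mulr_sumr.
by apply: ler_sum => i _; rewrite normrZ ler_wpM2r // xi'P.
Qed.

(** An approximable operator is within any [d > 0] of a finite rank one, so the finite rank bound
    extends to it; the supremum over [n] then produces [supnorm a]. *)
Lemma psi_qnorm_ge a c : c0 a -> 0 < c ->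
  (forall V : X -> X, finite_rank V ->
     (c%:E <= ereal_sup [set (`|y - V y|)%:E | y in K_set x])%E) ->
  c * supnorm a <= qnorm (psi a).
Proof.
move=> ca c_gt0 hc.
have h n T : approximable T -> c * `|a n| <= opnorm (fun z => psi a z - T z).
  move=> [bT aT]; apply/ler_addgt0Pr => d d0.
  have [T' [frT' TT']] := aT d d0.
  apply: le_trans (psi_finite_rank_dist n ca hc frT') _.
  apply: opnorm_le => z z1; have [bT' _] := frT'.
  rewrite -(subrKA (T z)) (le_trans (ler_normD _ _)) // lerD //.
    by apply: (@opnorm_ge _ _ _ (fun z => psi a z - T z)) => //;
       apply: bounded_linearB => //; exact: psi_bounded.
  apply: le_trans TT'; apply: (@opnorm_ge _ _ _ (fun z => T z - T' z)) => //.
  exact: bounded_linearB.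
apply: lb_le_inf.
  by exists (opnorm (fun z => psi a z - 0)), (fun=> 0) => //; exact: approximable0.
move=> _ [T aT <-]; rewrite mulrC -ler_pdivlMr //; apply: ge_sup.
  by exists `|a 0%N|, 0%N.
by move=> _ [n _ <-]; rewrite ler_pdivlMr // mulrC; exact: h.
Qed.

End EmbeddingBounds.

(** * The embedding of [c0] into the quotient algebra *)

Unset Implicit Arguments.

Theorem theorem3p3 (R : realType) (X : completeNormedModType R)
  (x : nat -> X) (c : R) (Z : completeNormedModType R) (J : (R -> X) -> Z) :
  ~ has_AP X ->
  (forall n, 0 < `|x n| <= 1) ->
  (fun n => `|x n|) @ \oo --> (0 : R) ->
  0 < c ->
  (forall V : X -> X, finite_rank V ->
     (c%:E <= ereal_sup [set (`|y - V y|)%:E | y in K_set x])%E) ->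
  is_completion x J ->
  exists psi : (nat -> R) -> Z -> Z,
    (forall a, c0 a -> compact_op (psi a)) /\
    (forall (a b : nat -> R) (al be : R), c0 a -> c0 b ->
       approximable (fun z => psi (fun n => al * a n + be * b n) z
                              - (al *: psi a z + be *: psi b z))) /\
    exists m M : R, 0 < m /\ 0 < M /\
      forall a, c0 a -> m * supnorm a <= qnorm (psi a) <= M * supnorm a.
Proof.
move=> _ x01 x_cvg0 c_gt0 hc JZ.
have [S SP] := embedding_operators x01 JZ.
exists (psi J S); split; first by move=> a ca; exact: (psi_compact x01 x_cvg0 JZ SP ca).
split.
  move=> a b al be ca cb.
  (* Linearity holds already for the operators themselves, before passing to the quotient. *)
  rewrite (_ : (fun z => _) = fun=> 0); first exact: approximable0.
  by apply/funext => z; rewrite (psi_additive x01 JZ SP al be ca cb) subrr.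
(* The lower constant is the distance [c] that [K] keeps from finite rank approximation. *)
exists c, 1; do 2![split=> //] => a ca; rewrite mul1r.
by rewrite (psi_qnorm_ge x01 x_cvg0 JZ SP ca c_gt0 hc) (psi_qnorm_le x01 JZ SP ca).
Qed.
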